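(* Let $\Gamma$ be an arbitrary digraph and $L(\Gamma)=L_{\mathbb{F}}(\Gamma)$ its Leavitt path algebra over a field $\mathbb{F}$. Then there is a one-to-one correspondence between the (two-sided) non-graded ideals of $L(\Gamma)$ and quadruples $(H,S,\beta,\theta)$ where $H$ is a hereditary and saturated subset of $V$, $S$ is a subset of the set $B_H$ of breaking vertices of $H$, $\beta$ is a nonempty collection of (geometric) cycles with no exit in $\Gamma/(H,S)$, and $\theta$ is a function from $\beta$ to polynomials $f(x)\in\mathbb{F}[x]$ of positive degree with $f(0)=1$.
   Context: A digraph $\Gamma=(V,E,s,t)$ consists of arbitrary (possibly infinite) sets $V$ of vertices and $E$ of arrows and functions $s,t:E\to V$ (source, target). The Leavitt path algebra $L(\Gamma)=L_{\mathbb{F}}(\Gamma)$ is the (not necessarily unital) $\mathbb{F}$-algebra generated by $V\sqcup E\sqcup\{e^*: e\in E\}$ subject to: $uv=\delta_{u,v}u$ for $u,v\in V$; $s(e)e=e=e\,t(e)$ and $t(e)e^*=e^*=e^*s(e)$ for $e\in E$; (CK1) $e^*f=\delta_{e,f}t(e)$ for $e,f\in E$; (CK2) $v=\sum_{s(e)=v}ee^*$ for every $v\in V$ with $0<|s^{-1}(v)|<\infty$. It is $\mathbb{Z}$-graded with $\deg v=0$ for $v\in V$, and $\deg e=1$, $\deg e^*=-1$ for $e\in E$. An ideal is graded if it is generated by homogeneous elements, and non-graded otherwise. A path of length $n>0$ is a sequence of arrows $e_1\cdots e_n$ with $t(e_i)=s(e_{i+1})$ for $1\le i<n$; its source is $s(e_1)$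 and its target is $t(e_n)$. A path of length $0$ is a single vertex, which is its own source and target. A cycle is a path $C=e_1\cdots e_n$ with $n>0$, $s(C)=t(C)$ and $s(e_1),\dots,s(e_n)$ distinct; cycles differing by a cyclic rotation are identified (geometric cycles). An exit of a path $p$ is an arrow not on $p$ whose source is a vertex on $p$. A subset $H\subseteq V$ is hereditary if $u\in H$ and the existence of a path from $u$ to $w$ imply $w\in H$; it is saturated if $0<|s^{-1}(u)|<\infty$ and $\{t(e): e\in s^{-1}(u)\}\subseteq H$ imply $u\in H$. The set of breaking vertices of $H$ is $B_H=\{v\in V: s^{-1}(v)\text{ is infinite and }0<|s^{-1}(v)\cap t^{-1}(V\setminus H)|<\infty\}$. For $H$ hereditary and saturated and $S\subseteq B_H$, the digraph $\Gamma/(H,S)$ has vertex set $(V\setminus H)\cup\{v': v\in B_H\setminus S\}$ and arrow set $\{e\in E: t(e)\notin H\}\cup\{e': e\in E,\ t(e)\in B_H\setminus S\}$, with $s,t$ extended by $s(e')=s(e)$ and $t(e')=t(e)'$. *)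

(* Defs.v *)
From HB Require Import structures.
From mathcomp Require Import all_boot all_order all_algebra finmap.
From mathcomp Require Import boolp classical_sets functions cardinality fsbigop.

Set Implicit Arguments.
Unset Strict Implicit.
Unset Printing Implicit Defensive.

Import GRing.Theory.

Local Open Scope classical_set_scope.
Local Open Scope ring_scope.
Local Open Scope quotient_scope.

Record digraph := Digraph {
  vertex : Type;
  arrow : Type;
  source : arrow -> vertex;
  target : arrow -> vertex }.

(* Vertices and arrows range over arbitrary types; classical logic provides the
   choiceType structures required by [uniq], [\in], [fset_set] and the finitely
   supported sums of fsbigop. *)
HB.instance Definition _ (G : digraph) := gen_eqMixin (vertex G).
HB.instance Definition _ (G : digraph) := gen_choiceMixin (vertex G).
HB.instance Definition _ (G : digraph) := gen_eqMixin (arrow G).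
HB.instance Definition _ (G : digraph) := gen_choiceMixin (arrow G).

Section Digraphs.
Variable G : digraph.
Implicit Types (u v w : vertex G) (e f : arrow G) (p : seq (arrow G)).

Definition out_arrows v : set (arrow G) := [set e | source e = v].

(* [is_path u p w]: the arrows of [p], in this order, form a path from [u] to
   [w]; the path of length 0 at [u] is [p = [::]] with [w = u]. *)
Fixpoint is_path u p w : Prop :=
  if p is e :: q then source e = u /\ is_path (target e) q w else u = w.

Definition is_cycle p : Prop :=
  [/\ p != [::], exists v, is_path v p v & uniq (map (@source G) p)].

(* A geometric cycle is the class of a cycle modulo cyclic rotation. *)
Definition rotations p : set (seq (arrow G)) := [set rot n p | n in setT].

Definition geometric_cycle : Type :=
  {C : set (seq (arrow G)) | exists2 p, is_cycle p & C = rotations p}.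

Definition on_path v p : Prop :=
  exists2 e, e \in p & v = source e \/ v = target e.

Definition is_exit e p : Prop := e \notin p /\ on_path (source e) p.

Definition no_exit (C : geometric_cycle) : Prop :=
  forall p, sval C p -> forall e, ~ is_exit e p.

Definition hereditary (H : set (vertex G)) : Prop :=
  forall u w p, H u -> is_path u p w -> H w.

Definition saturated (H : set (vertex G)) : Prop :=
  forall u, finite_set (out_arrows u) -> out_arrows u !=set0 ->
    @target G @` out_arrows u `<=` H -> H u.

Definition out_arrows_avoiding (H : set (vertex G)) v : set (arrow G) :=
  out_arrows v `&` @target G @^-1` (~` H).

Definition breaking (H : set (vertex G)) : set (vertex G) :=
  [set v | [/\ infinite_set (out_arrows v),
               finite_set (out_arrows_avoiding H v) &
               out_arrows_avoiding H v !=set0]].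

Record admissible_pair := AdmissiblePair {
  ap_H : set (vertex G);
  ap_S : set (vertex G);
  ap_hereditary : hereditary ap_H;
  ap_saturated : saturated ap_H;
  ap_breaking : ap_S `<=` breaking ap_H }.

End Digraphs.

Section QuotientDigraph.
Variables (G : digraph) (P : admissible_pair G).

(* [inl] is for the elements of [G] that are kept, [inr] for the primed copies. *)
Definition quotient_vertex : Type :=
  (~` ap_H P + (breaking (ap_H P) `\` ap_S P))%type.

Definition quotient_arrow : Type :=
  ([set e | ~ ap_H P (target e)] +
   [set e | (breaking (ap_H P) `\` ap_S P) (target e)])%type.

Definition underlying_vertex (v : quotient_vertex) : vertex G :=
  match v with inl u => val u | inr u => val u end.

Definition underlying_arrow (e : quotient_arrow) : arrow G :=
  match e with inl f => val f | inr f => val f end.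

Lemma breaking_notin v : breaking (ap_H P) v -> ~ ap_H P v.
Proof.
move=> [_ _ [e [/= se te]]] Hv; apply: te => /=.
exact: (@ap_hereditary _ P v (target e) [:: e] Hv).
Qed.

Lemma quotient_source_proof (e : quotient_arrow) :
  source (underlying_arrow e) \in ~` ap_H P.
Proof.
have tP : ~ ap_H P (target (underlying_arrow e)).
  by case: e => [[e /= /set_mem//]|[e /= /set_mem[/breaking_notin]]].
apply: mem_set => /= Hs; apply: tP.
exact: (@ap_hereditary _ P _ _ [:: underlying_arrow e] Hs).
Qed.

Definition quotient_source (e : quotient_arrow) : quotient_vertex :=
  inl (exist _ (source (underlying_arrow e)) (quotient_source_proof e)).

Lemma quotient_target_proof (e : [set e | ~ ap_H P (target e)]) :
  target (val e) \in ~` ap_H P.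
Proof. by case: e => e /= /set_mem te; exact: mem_set. Qed.

Lemma quotient_target'_proof
    (e : [set e | (breaking (ap_H P) `\` ap_S P) (target e)]) :
  target (val e) \in breaking (ap_H P) `\` ap_S P.
Proof. by case: e => e /= /set_mem te; exact: mem_set. Qed.

Definition quotient_target (e : quotient_arrow) : quotient_vertex :=
  match e with
  | inl f => inl (exist _ (target (val f)) (quotient_target_proof f))
  | inr f => inr (exist _ (target (val f)) (quotient_target'_proof f))
  end.

Definition quotient_digraph : digraph :=
  {| vertex := quotient_vertex; arrow := quotient_arrow;
     source := quotient_source; target := quotient_target |}.

End QuotientDigraph.

(* The Leavitt path algebra is the quotient of the type of all formal
   expressions in the generators by the least congruence containing the axioms
   of (associative, not necessarily unital) algebras and the defining relations.
   The opposite of [a] is [TScale (-1) a]. *)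
Section Presentation.
Variables (F : fieldType) (G : digraph).

Inductive lpa_term : Type :=
| TVertex of vertex G
| TArrow of arrow G
| TGhost of arrow G
| TZero
| TAdd of lpa_term & lpa_term
| TScale of F & lpa_term
| TMul of lpa_term & lpa_term.

HB.instance Definition _ := gen_eqMixin lpa_term.
HB.instance Definition _ := gen_choiceMixin lpa_term.

Inductive lpa_cong : lpa_term -> lpa_term -> Prop :=
| Crefl a : lpa_cong a a
| Csym a b : lpa_cong a b -> lpa_cong b a
| Ctrans a b c : lpa_cong a b -> lpa_cong b c -> lpa_cong a c
| Cadd a a' b b' : lpa_cong a a' -> lpa_cong b b' ->
    lpa_cong (TAdd a b) (TAdd a' b')
| Cscale k a a' : lpa_cong a a' -> lpa_cong (TScale k a) (TScale k a')
| Cmul a a' b b' : lpa_cong a a' -> lpa_cong b b' ->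
    lpa_cong (TMul a b) (TMul a' b')
| CaddA a b c : lpa_cong (TAdd a (TAdd b c)) (TAdd (TAdd a b) c)
| CaddC a b : lpa_cong (TAdd a b) (TAdd b a)
| Cadd0 a : lpa_cong (TAdd TZero a) a
| CaddN a : lpa_cong (TAdd (TScale (-1) a) a) TZero
| CscaleA k l a : lpa_cong (TScale k (TScale l a)) (TScale (k * l) a)
| Cscale1 a : lpa_cong (TScale 1 a) a
| CscaleDr k a b :
    lpa_cong (TScale k (TAdd a b)) (TAdd (TScale k a) (TScale k b))
| CscaleDl k l a :
    lpa_cong (TScale (k + l) a) (TAdd (TScale k a) (TScale l a))
| CmulA a b c : lpa_cong (TMul a (TMul b c)) (TMul (TMul a b) c)
| CmulDl a b c : lpa_cong (TMul (TAdd a b) c) (TAdd (TMul a c) (TMul b c))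
| CmulDr a b c : lpa_cong (TMul a (TAdd b c)) (TAdd (TMul a b) (TMul a c))
| CscaleAl k a b : lpa_cong (TScale k (TMul a b)) (TMul (TScale k a) b)
| CscaleAr k a b : lpa_cong (TScale k (TMul a b)) (TMul a (TScale k b))
| Cvertex_id v : lpa_cong (TMul (TVertex v) (TVertex v)) (TVertex v)
| Cvertex_orth u v : u <> v -> lpa_cong (TMul (TVertex u) (TVertex v)) TZero
| Csource_arrow e : lpa_cong (TMul (TVertex (source e)) (TArrow e)) (TArrow e)
| Carrow_target e : lpa_cong (TMul (TArrow e) (TVertex (target e))) (TArrow e)
| Ctarget_ghost e : lpa_cong (TMul (TVertex (target e)) (TGhost e)) (TGhost e)
| Cghost_source e : lpa_cong (TMul (TGhost e) (TVertex (source e))) (TGhost e)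
| CCK1_id e : lpa_cong (TMul (TGhost e) (TArrow e)) (TVertex (target e))
| CCK1_orth e f : e <> f -> lpa_cong (TMul (TGhost e) (TArrow f)) TZero
| CCK2 v : finite_set (out_arrows v) -> out_arrows v !=set0 ->
    lpa_cong (TVertex v)
      (\big[TAdd/TZero]_(e <- fset_set (out_arrows v))
         TMul (TArrow e) (TGhost e)).

Definition lpa_congb : rel lpa_term := fun a b => `[< lpa_cong a b >].

Lemma lpa_congb_refl : reflexive lpa_congb.
Proof. by move=> a; apply/asboolP/Crefl. Qed.

Lemma lpa_congb_sym : symmetric lpa_congb.
Proof. by move=> a b; apply/asboolP/asboolP; apply: Csym. Qed.

Lemma lpa_congb_trans : transitive lpa_congb.
Proof.
by move=> b a c /asboolP ab /asboolP bc; apply/asboolP; apply: Ctrans ab bc.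
Qed.

Canonical lpa_equiv := EquivRel lpa_congb
  lpa_congb_refl lpa_congb_sym lpa_congb_trans.

Definition lpa : Type := {eq_quot lpa_equiv}.

HB.instance Definition _ := Choice.on lpa.
HB.instance Definition _ := Quotient.on lpa.
HB.instance Definition _ := EqQuotient.on lpa.

Lemma lpa_piP (a b : lpa_term) : \pi_lpa a = \pi_lpa b <-> lpa_cong a b.
Proof. by split=> [/eqmodP /asboolP //|ab]; apply/eqmodP/asboolP. Qed.

Lemma lpa_repr_pi (a : lpa_term) : lpa_cong (repr (\pi_lpa a)) a.
Proof. by apply/lpa_piP; rewrite reprK. Qed.

Definition lpa_vertex (v : vertex G) : lpa := \pi_lpa (TVertex v).
Definition lpa_arrow (e : arrow G) : lpa := \pi_lpa (TArrow e).
Definition lpa_ghost (e : arrow G) : lpa := \pi_lpa (TGhost e).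

Definition lpa_zero : lpa := \pi_lpa TZero.
Definition lpa_add (x y : lpa) : lpa := \pi_lpa (TAdd (repr x) (repr y)).
Definition lpa_scale (k : F) (x : lpa) : lpa := \pi_lpa (TScale k (repr x)).
Definition lpa_opp (x : lpa) : lpa := lpa_scale (-1) x.
Definition lpa_mul (x y : lpa) : lpa := \pi_lpa (TMul (repr x) (repr y)).

Lemma lpa_addE a b : lpa_add (\pi_lpa a) (\pi_lpa b) = \pi_lpa (TAdd a b).
Proof. by apply/lpa_piP; apply: Cadd; exact: lpa_repr_pi. Qed.

Lemma lpa_scaleE k a : lpa_scale k (\pi_lpa a) = \pi_lpa (TScale k a).
Proof. by apply/lpa_piP; apply: Cscale; exact: lpa_repr_pi. Qed.

Lemma lpa_mulE a b : lpa_mul (\pi_lpa a) (\pi_lpa b) = \pi_lpa (TMul a b).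
Proof. by apply/lpa_piP; apply: Cmul; exact: lpa_repr_pi. Qed.

Lemma lpa_ind (Q : lpa -> Prop) : (forall a, Q (\pi_lpa a)) -> forall x, Q x.
Proof. by move=> Qpi x; rewrite -[x]reprK. Qed.

Lemma lpa_addA : associative lpa_add.
Proof.
elim/lpa_ind=> a; elim/lpa_ind=> b; elim/lpa_ind=> c.
by rewrite !lpa_addE; apply/lpa_piP; exact: CaddA.
Qed.

Lemma lpa_addC : commutative lpa_add.
Proof.
elim/lpa_ind=> a; elim/lpa_ind=> b.
by rewrite !lpa_addE; apply/lpa_piP; exact: CaddC.
Qed.

Lemma lpa_add0 : left_id lpa_zero lpa_add.
Proof.
by elim/lpa_ind=> a; rewrite lpa_addE; apply/lpa_piP; exact: Cadd0.
Qed.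

Lemma lpa_addN : left_inverse lpa_zero lpa_opp lpa_add.
Proof.
elim/lpa_ind=> a; rewrite /lpa_opp lpa_scaleE lpa_addE.
by apply/lpa_piP; exact: CaddN.
Qed.

HB.instance Definition _ :=
  GRing.isZmodule.Build lpa lpa_addA lpa_addC lpa_add0 lpa_addN.

Lemma lpa_scaleA k l x : lpa_scale k (lpa_scale l x) = lpa_scale (k * l) x.
Proof.
by elim/lpa_ind: x => a; rewrite !lpa_scaleE; apply/lpa_piP; exact: CscaleA.
Qed.

Lemma lpa_scale1 : left_id 1 lpa_scale.
Proof.
by elim/lpa_ind=> a; rewrite lpa_scaleE; apply/lpa_piP; exact: Cscale1.
Qed.

Lemma lpa_scaleDr : right_distributive lpa_scale +%R.
Proof.
move=> k; elim/lpa_ind=> a; elim/lpa_ind=> b.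
rewrite /GRing.add /= lpa_addE !lpa_scaleE lpa_addE.
by apply/lpa_piP; exact: CscaleDr.
Qed.

Lemma lpa_scaleDl x : {morph lpa_scale^~ x : k l / k + l}.
Proof.
elim/lpa_ind: x => a k l; rewrite [in RHS]/GRing.add /= !lpa_scaleE lpa_addE.
by apply/lpa_piP; exact: CscaleDl.
Qed.

HB.instance Definition _ := GRing.Zmodule_isLmodule.Build F lpa
  lpa_scaleA lpa_scale1 lpa_scaleDr lpa_scaleDl.

Lemma lpa_mulA : associative lpa_mul.
Proof.
elim/lpa_ind=> a; elim/lpa_ind=> b; elim/lpa_ind=> c.
by rewrite !lpa_mulE; apply/lpa_piP; exact: CmulA.
Qed.

Lemma lpa_mulDl : left_distributive lpa_mul +%R.
Proof.
elim/lpa_ind=> a; elim/lpa_ind=> b; elim/lpa_ind=> c.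
rewrite /GRing.add /= lpa_addE !lpa_mulE lpa_addE.
by apply/lpa_piP; exact: CmulDl.
Qed.

Lemma lpa_mulDr : right_distributive lpa_mul +%R.
Proof.
elim/lpa_ind=> a; elim/lpa_ind=> b; elim/lpa_ind=> c.
rewrite /GRing.add /= lpa_addE !lpa_mulE lpa_addE.
by apply/lpa_piP; exact: CmulDr.
Qed.

Lemma lpa_scaleAl k x y : k *: lpa_mul x y = lpa_mul (k *: x) y.
Proof.
elim/lpa_ind: x => a; elim/lpa_ind: y => b.
rewrite /GRing.scale /= lpa_mulE !lpa_scaleE lpa_mulE.
by apply/lpa_piP; exact: CscaleAl.
Qed.

Lemma lpa_scaleAr k x y : k *: lpa_mul x y = lpa_mul x (k *: y).
Proof.
elim/lpa_ind: x => a; elim/lpa_ind: y => b.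
rewrite /GRing.scale /= lpa_mulE !lpa_scaleE lpa_mulE.
by apply/lpa_piP; exact: CscaleAr.
Qed.

Lemma lpa_CK2 v : finite_set (out_arrows v) -> out_arrows v !=set0 ->
  lpa_vertex v =
    \sum_(e \in out_arrows v) lpa_mul (lpa_arrow e) (lpa_ghost e).
Proof.
move=> fin ne; rewrite fsbig_finite//=.
transitivity (\pi_lpa (\big[TAdd/TZero]_(e <- fset_set (out_arrows v))
         TMul (TArrow e) (TGhost e))); first exact/lpa_piP/CCK2.
elim: (enum_fset _) => [|e r IH]; first by rewrite !big_nil.
by rewrite !big_cons -IH lpa_mulE [in RHS]/GRing.add /= lpa_addE.
Qed.

End Presentation.

Section Ideals.
Variables (F : fieldType) (G : digraph).
Local Notation L := (lpa F G).

Record is_ideal (I : set L) : Prop := IsIdeal {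
  ideal0 : I 0;
  idealD : forall x y, I x -> I y -> I (x + y);
  idealZ : forall k x, I x -> I (k *: x);
  idealMl : forall x y, I y -> I (lpa_mul x y);
  idealMr : forall x y, I x -> I (lpa_mul x y) }.

Definition ideal_generated (X : set L) : set L := smallest is_ideal X.

(* [has_degree n x]: [x] lies in the degree [n] component, i.e. in the span of
   the products of generators whose degrees add up to [n]. *)
Inductive has_degree : int -> L -> Prop :=
| deg_vertex v : has_degree 0 (lpa_vertex F v)
| deg_arrow e : has_degree 1 (lpa_arrow F e)
| deg_ghost e : has_degree (-1) (lpa_ghost F e)
| deg_zero n : has_degree n 0
| deg_add n x y : has_degree n x -> has_degree n y -> has_degree n (x + y)
| deg_scale n k x : has_degree n x -> has_degree n (k *: x)
| deg_mul m n x y :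
    has_degree m x -> has_degree n y -> has_degree (m + n) (lpa_mul x y).

Definition homogeneous (x : L) : Prop := exists n, has_degree n x.

Definition graded_ideal (I : set L) : Prop :=
  exists2 X : set L, X `<=` homogeneous & I = ideal_generated X.

Definition nongraded_ideal : Type :=
  {I : set L | is_ideal I /\ ~ graded_ideal I}.

End Ideals.

(* The data (H, S, beta, theta), with (H, S) packaged in [quad_pair]. *)
Record quadruple (F : fieldType) (G : digraph) := Quadruple {
  quad_pair : admissible_pair G;
  quad_beta : set (geometric_cycle (quotient_digraph quad_pair));
  quad_beta_neq0 : quad_beta !=set0;
  quad_beta_no_exit : forall C, quad_beta C -> no_exit C;
  quad_theta : quad_beta -> {f : {poly F} | (1 < size f)%N && (f.[0] == 1)} }.

Arguments quad_beta {F G} q _.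
Arguments quad_theta {F G} q _.

Section IdealOfQuadruple.
Variables (F : fieldType) (G : digraph).
Local Notation L := (lpa F G).

(* The element of [L] given by a path [p] with source [v]. *)
Definition lpa_path (v : vertex G) (p : seq (arrow G)) : L :=
  foldl (fun x e => lpa_mul x (lpa_arrow F e)) (lpa_vertex F v) p.

(* [f] evaluated at a closed path based at [v]; the zeroth power is [v]. *)
Definition lpa_eval (f : {poly F}) (v : vertex G) (p : seq (arrow G)) : L :=
  \sum_(i < size f)
     f`_i *: iter i (fun x => lpa_mul x (lpa_path v p)) (lpa_vertex F v).

(* [v^H], i.e. [v] minus the sum of the [e e^*] with [s(e) = v], [t(e)] not in
   [H]; meaningful for [v] in [breaking H], where the sum is finite. *)
Definition breaking_element (H : set (vertex G)) (v : vertex G) : L :=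
  lpa_vertex F v -
  \sum_(e \in out_arrows_avoiding H v) lpa_mul (lpa_arrow F e) (lpa_ghost F e).

(* An exit-free cycle [C] of the quotient digraph has no primed arrow (primed
   vertices are sinks), so it is a cycle of [G] and its polynomial
   [f = theta C] can be evaluated in [L]. All rotations of [C] are used as
   generators; they generate the same ideal since
   [e1^* f(e1 e2 .. en) e1 = f(e2 .. en e1)]. *)
Definition quadruple_generators (q : quadruple F G) : set L :=
  let P := quad_pair q in
  (@lpa_vertex F G @` ap_H P) `|`
  (breaking_element (ap_H P) @` ap_S P) `|`
  [set x | exists (C : quad_beta q) (v : vertex (quotient_digraph P))
                  (p : seq (arrow (quotient_digraph P))),
     [/\ sval (val C) p, is_path v p v &
         x = lpa_eval (val (quad_theta q C)) (underlying_vertex v)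
               (map (@underlying_arrow G P) p)]].

End IdealOfQuadruple.

(* Main.v *)
Require Import Defs.
From HB Require Import structures.
From mathcomp Require Import all_boot all_order all_algebra finmap.
From mathcomp Require Import boolp classical_sets functions cardinality fsbigop.

(* A quadruple [q] has a module that is killed by its ideal [K]: the functions
   [m : X -> int -> F], where [X] is the set of boundary paths of the quotient
   digraph and the second argument is a degree, that satisfy the recurrence of
   polynomial [theta(C)] in the degree on every path that ends up in a cycle [C]
   of [beta]. As [theta(C)] has nonzero constant term, there are enough two-sided
   solutions to show that [K] contains no other vertex, no other [v^H] and no
   other polynomial in a cycle than expected; this gives back [q] from [K].
   Restricting a solution to one degree destroys the recurrence but is harmless
   to homogeneous elements, so that [K] is not graded.

   Conversely, let [K <= I] be ideals that have the same vertices, the same [v^H]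
   and the same polynomials in exit-free cycles, and let [x] be in [I] but not in
   [K]. Multiplying [x] by arrows on the right, then by ghost arrows on the left,
   one gets in [I \ K] an element [k v + ...], with [k <> 0] and a combination of
   closed paths at [v]. Conjugation by a path that no closed path of the
   combination follows would give a vertex in [I]: hence paths issued from [v] do
   not branch, and the element is a polynomial in an exit-free cycle. *)

Set Implicit Arguments.
Unset Strict Implicit.
Unset Printing Implicit Defensive.

(* [Defs] is imported again because mathcomp also declares names such as
   [idealMr]. *)
Import Defs GRing.Theory.
Local Open Scope classical_set_scope.
Local Open Scope ring_scope.
Local Open Scope quotient_scope.

Local Notation "x ** y" := (lpa_mul x y) (at level 40, left associativity).

(** * Paths in the Leavitt path algebra *)

Section Paths.
Variable G : digraph.
Implicit Types (u v w : vertex G) (e f : arrow G) (p q : seq (arrow G)).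

(** All computations stay in [lpa F G] and on paths of [G]: an exit-free cycle of the quotient has
    only unprimed arrows, and a boundary path that ends at a primed vertex is recorded as a path
    that stops at the underlying vertex. The module consists of all functions, without condition on
    supports, because a nonzero two-sided solution of a recurrence has infinite support in the
    degree. The obstacle in the converse is a vertex [v] where (CK2) fails modulo [K]: from [x v]
    outside [K] one cannot infer that some [x e] is outside [K]. There [x] is multiplied by [v]
    minus finitely many [e e^*], which erases the ghost arrows at once; the element [k v + ...]
    obtained afterwards forces [v] to be regular in the quotient, so that this case is
    contradictory. That [beta] is nonempty comes from non-gradedness: without any polynomial, the
    ideal is generated by vertices and by the [v^H], all of degree 0. *)

Lemma is_path_cat u p q w :
  is_path u (p ++ q) w <-> exists2 v, is_path u p v & is_path v q w.
Proof.
elim: p u => [|e p IH] u /=.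
  by split=> [?|[v ->]//]; exists u.
split=> [[se /IH[v pv qv]]|[v [se pv] qv]]; first by exists v.
by split=> //; apply/IH; exists v.
Qed.

Lemma is_path_start u u' p w w' : p != [::] ->
  is_path u p w -> is_path u' p w' -> u = u'.
Proof. by case: p => // e p _ /= [<- _] [<- _]. Qed.

Definition pow p i : seq (arrow G) := flatten (nseq i p).

Lemma powSr p i : pow p i ++ p = pow p i.+1.
Proof.
elim: i => [|i IH]; first by rewrite /pow /= cats0.
by rewrite /pow /= -/(pow p i) -catA IH.
Qed.

Lemma pow_path v p i : is_path v p v -> is_path v (pow p i) v.
Proof. by move=> pv; elim: i => //= i IH; apply/is_path_cat; exists v. Qed.

(** The list form of [(e q)^i e = e (q e)^i], by which conjugation by [e] rotates a cycle. *)
Lemma pow_rot e q i : rcons (pow (e :: q) i) e = e :: pow (rcons q e) i.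
Proof.
by elim: i => //= i IH; rewrite rcons_cat IH /pow /= cat_rcons.
Qed.

Lemma rot_path u p n : is_path u p u -> (n <= size p)%N ->
  exists v, is_path v (rot n p) v.
Proof.
move=> pu np; have := pu; rewrite -{1}(cat_take_drop n p) => /is_path_cat[v p1 p2].
by exists v; apply/is_path_cat; exists u.
Qed.

End Paths.

Section Algebra.
Variables (F : fieldType) (G : digraph).
Local Notation L := (lpa F G).
Implicit Types (u v w : vertex G) (e f : arrow G) (p q : seq (arrow G)).
Implicit Types (x y z : L).
Local Notation V := (lpa_vertex F).
Local Notation A := (lpa_arrow F).
Local Notation A' := (lpa_ghost F).

(** The algebra has no unit in general and carries no ring structure; linearity of both
    multiplications provides the rules for sums, differences and zero. *)
Lemma lpa_mul_linear x : linear (lpa_mul x).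
Proof. by move=> k y z; rewrite lpa_mulDr -lpa_scaleAr. Qed.
HB.instance Definition _ x :=
  GRing.isLinear.Build F L L *:%R (lpa_mul x) (lpa_mul_linear x).

Definition lpa_mulr y x : L := x ** y.
Lemma lpa_mulr_linear y : linear (lpa_mulr y).
Proof. by move=> k x z; rewrite /lpa_mulr lpa_mulDl -lpa_scaleAl. Qed.
HB.instance Definition _ y :=
  GRing.isLinear.Build F L L *:%R (lpa_mulr y) (lpa_mulr_linear y).

Lemma lpa_mulx0 x : x ** 0 = 0. Proof. exact: linear0. Qed.
Lemma lpa_mul0x x : 0 ** x = 0. Proof. exact: (linear0 (lpa_mulr x)). Qed.
Lemma lpa_mulBr x y z : x ** (y - z) = x ** y - x ** z.
Proof. exact: linearB. Qed.
Lemma lpa_mulBl x y z : (x - y) ** z = x ** z - y ** z.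
Proof. exact: (linearB (lpa_mulr z)). Qed.
Lemma lpa_mulZr k x y : x ** (k *: y) = k *: (x ** y).
Proof. by rewrite lpa_scaleAr. Qed.
Lemma lpa_mulZl k x y : (k *: x) ** y = k *: (x ** y).
Proof. by rewrite lpa_scaleAl. Qed.
Lemma lpa_mul_sumr (I : Type) (r : seq I) P (E : I -> L) x :
  x ** (\sum_(i <- r | P i) E i) = \sum_(i <- r | P i) x ** E i.
Proof. exact: linear_sum. Qed.
Lemma lpa_mul_suml (I : Type) (r : seq I) P (E : I -> L) x :
  (\sum_(i <- r | P i) E i) ** x = \sum_(i <- r | P i) E i ** x.
Proof. exact: (linear_sum (lpa_mulr x)). Qed.

Lemma vertex_vertex u v : V u ** V v = if u == v then V u else 0.
Proof.
rewrite /lpa_vertex lpa_mulE; case: eqP => [<-|uv]; apply/lpa_piP.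
  exact: Cvertex_id.
exact: Cvertex_orth.
Qed.

Lemma source_arrow e : V (source e) ** A e = A e.
Proof. by rewrite /lpa_vertex /lpa_arrow lpa_mulE; apply/lpa_piP/Csource_arrow. Qed.
Lemma arrow_target e : A e ** V (target e) = A e.
Proof. by rewrite /lpa_vertex /lpa_arrow lpa_mulE; apply/lpa_piP/Carrow_target. Qed.
Lemma target_ghost e : V (target e) ** A' e = A' e.
Proof. by rewrite /lpa_vertex /lpa_ghost lpa_mulE; apply/lpa_piP/Ctarget_ghost. Qed.
Lemma ghost_source e : A' e ** V (source e) = A' e.
Proof. by rewrite /lpa_vertex /lpa_ghost lpa_mulE; apply/lpa_piP/Cghost_source. Qed.

Lemma ghost_arrow e f : A' e ** A f = if e == f then V (target e) else 0.
Proof.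
rewrite /lpa_ghost /lpa_arrow lpa_mulE.
case: eqP => [<-|ef]; apply/lpa_piP; [exact: CCK1_id|exact: CCK1_orth].
Qed.

Lemma vertex_arrow v e : V v ** A e = if v == source e then A e else 0.
Proof.
rewrite -{1}source_arrow lpa_mulA vertex_vertex.
by case: eqP => [->|_]; rewrite ?source_arrow ?lpa_mul0x.
Qed.
Lemma ghost_vertex e v : A' e ** V v = if source e == v then A' e else 0.
Proof.
rewrite -{1}ghost_source -lpa_mulA vertex_vertex.
by case: eqP => _; rewrite ?lpa_mulx0 ?ghost_source.
Qed.

(* The path is anchored at its target, so that consing an arrow is a left
   multiplication. *)
Fixpoint rpath p w : L := if p is e :: q then A e ** rpath q w else V w.
Fixpoint gpath p w : L := if p is e :: q then gpath q w ** A' e else V w.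

Lemma rpath_vertex p w v : rpath p w ** V v = if w == v then rpath p w else 0.
Proof.
elim: p => [|e p IH] /=; first exact: vertex_vertex.
by rewrite -lpa_mulA IH; case: eqP => // _; rewrite lpa_mulx0.
Qed.

Lemma vertex_rpath v u p w : is_path u p w ->
  V v ** rpath p w = if v == u then rpath p w else 0.
Proof.
case: p => [<-|e p] /=; first by rewrite vertex_vertex; case: eqP => // ->.
by move=> [<- _]; rewrite lpa_mulA vertex_arrow; case: eqP; rewrite ?lpa_mul0x.
Qed.

Lemma rpath_cat p q u w : is_path u q w ->
  rpath p u ** rpath q w = rpath (p ++ q) w.
Proof.
move=> qw; elim: p => [|e p IH] /=; first by rewrite (vertex_rpath _ qw) eqxx.
by rewrite -lpa_mulA IH.
Qed.

Lemma gpathK u p w : is_path u p w -> gpath p w ** rpath p w = V w.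
Proof.
elim: p u => [|e p IH] u /=; first by rewrite vertex_vertex eqxx.
move=> [_ pw]; rewrite -lpa_mulA (lpa_mulA (A' e)) ghost_arrow eqxx.
by rewrite (vertex_rpath _ pw) eqxx; apply: IH pw.
Qed.

Lemma lpa_pathE u p w : is_path u p w -> lpa_path F u p = rpath p w.
Proof.
rewrite /lpa_path => pw.
(* [lpa_path] folds from the source and [rpath] from the target; the accumulator [x] may be any
   element that ends at [u]. *)
suff H x : x ** V u = x -> foldl (fun x e => x ** A e) x p = x ** rpath p w.
  by rewrite H ?vertex_vertex ?eqxx // (vertex_rpath _ pw) eqxx.
elim: p u pw x => [|e p IH] u /=; first by move=> <- x ->.
move=> [_ pw] x _; rewrite (IH _ pw) ?lpa_mulA //.
by rewrite -lpa_mulA arrow_target.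
Qed.

Lemma rpath_pow v p i : is_path v p v ->
  iter i (fun x => x ** rpath p v) (V v) = rpath (pow p i) v.
Proof.
move=> pv; elim: i => //= i ->; rewrite (rpath_cat _ pv); congr rpath.
exact: powSr.
Qed.

Lemma lpa_evalE (g : {poly F}) v p N : is_path v p v -> (size g <= N)%N ->
  lpa_eval g v p = \sum_(i < N) g`_i *: rpath (pow p i) v.
Proof.
move=> pv gN; rewrite /lpa_eval (lpa_pathE pv).
under eq_bigr do rewrite rpath_pow //.
rewrite (big_ord_widen _ (fun i => g`_i *: rpath (pow p i) v) gN) big_mkcond.
apply: eq_bigr => i _; case: ltnP => // gi.
by rewrite nth_default // scale0r.
Qed.

Lemma lpa_evalD (f g : {poly F}) v p : is_path v p v ->
  lpa_eval (f + g) v p = lpa_eval f v p + lpa_eval g v p.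
Proof.
move=> pv; set N := maxn (size f) (size g).
rewrite !(@lpa_evalE _ _ _ N pv) ?leq_maxl ?leq_maxr ?size_polyD //.
by rewrite -big_split; apply: eq_bigr => i _; rewrite coefD scalerDl.
Qed.

Lemma lpa_evalZ k (g : {poly F}) v p : is_path v p v ->
  lpa_eval (k *: g) v p = k *: lpa_eval g v p.
Proof.
move=> pv; rewrite !(@lpa_evalE _ _ _ (size g) pv) ?size_scale_leq //.
by rewrite scaler_sumr; apply: eq_bigr => i _; rewrite coefZ scalerA.
Qed.

Lemma lpa_eval_XM (g : {poly F}) v p : is_path v p v ->
  lpa_eval ('X * g) v p = rpath p v ** lpa_eval g v p.
Proof.
move=> pv; rewrite (@lpa_evalE _ _ _ (size g).+1 pv); last first.
  by rewrite (leq_trans (size_polyMleq _ _)) // size_polyX.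
rewrite (@lpa_evalE g _ _ (size g) pv) // big_ord_recl coefXM eqxx scale0r add0r.
rewrite lpa_mul_sumr; apply: eq_bigr => i _.
by rewrite lpa_mulZr (rpath_cat _ (pow_path i pv)) coefXM.
Qed.

Lemma lpa_eval_Xn v p i : is_path v p v ->
  lpa_eval 'X^i v p = rpath (pow p i) v.
Proof.
move=> pv; rewrite (@lpa_evalE _ _ _ i.+1 pv) ?size_polyXn //.
rewrite (bigD1 ord_max) //= coefXn eqxx scale1r big1 ?addr0 // => j.
by rewrite coefXn -val_eqE /= => /negbTE ->; rewrite scale0r.
Qed.

Lemma lpa_eval_rot1 (g : {poly F}) v e q : is_path v (e :: q) v ->
  A' e ** lpa_eval g v (e :: q) ** A e = lpa_eval g (target e) (rcons q e).
Proof.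
move=> pv; have [se qv] : source e = v /\ is_path (target e) q v by [].
have qe : is_path (target e) (rcons q e) (target e).
  by rewrite -cats1; apply/is_path_cat; exists v.
rewrite (lpa_evalE pv (leqnn _)) (lpa_evalE qe (leqnn _)).
rewrite lpa_mul_sumr lpa_mul_suml; apply: eq_bigr => i _.
rewrite lpa_mulZr lpa_mulZl -lpa_mulA; congr (_ *: _).
have -> : rpath (pow (e :: q) i) v ** A e = rpath (rcons (pow (e :: q) i) e) (target e).
  have ve : is_path v [:: e] (target e) by [].
  by rewrite -cats1 -(rpath_cat _ ve) /= arrow_target.
rewrite pow_rot /= lpa_mulA ghost_arrow eqxx.
by rewrite (vertex_rpath _ (pow_path _ qe)) eqxx.
Qed.

Section IdealTheory.
Variables (I : set L) (idI : is_ideal I).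

Lemma ideal_sum (J : Type) (r : seq J) (P : pred J) (E : J -> L) :
  (forall i, P i -> I (E i)) -> I (\sum_(i <- r | P i) E i).
Proof. by move=> IE; apply: big_ind => //; [exact: ideal0|exact: idealD]. Qed.
Lemma ideal_sum_in (J : choiceType) (r : seq J) (E : J -> L) :
  (forall i, i \in r -> I (E i)) -> I (\sum_(i <- r) E i).
Proof. by move=> IE; rewrite big_seq; apply: ideal_sum. Qed.
Lemma idealBl x y : I (x - y) -> I y -> I x.
Proof. by move=> xy /(idealD idI xy); rewrite subrK. Qed.
Lemma idealZV k x : k != 0 -> I (k *: x) -> I x.
Proof. by move=> k0 /(idealZ idI k^-1); rewrite scalerA mulVf // scale1r. Qed.

Lemma ideal_arrow e : I (V (target e)) -> I (A e).
Proof. by move=> It; rewrite -arrow_target; exact: (idealMl idI _ It). Qed.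
End IdealTheory.

Lemma ideal_generated_ideal (X : set L) : is_ideal (ideal_generated X).
Proof.
split.
- by move=> I [iI _]; apply: (ideal0 iI).
- by move=> x y Ix Iy I [iI XI]; apply: (idealD iI); [apply: Ix|apply: Iy].
- by move=> k x Ix I [iI XI]; apply: (idealZ iI); apply: Ix.
- by move=> x y Iy I [iI XI]; apply: (idealMl iI); apply: Iy.
- by move=> x y Ix I [iI XI]; apply: (idealMr iI); apply: Ix.
Qed.

Lemma sub_ideal_generated (X : set L) : X `<=` ideal_generated X.
Proof. exact: sub_gen_smallest. Qed.

Lemma ideal_generated_sub (X I : set L) : is_ideal I -> X `<=` I ->
  ideal_generated X `<=` I.
Proof. by move=> iI XI; apply: smallest_sub. Qed.

End Algebra.

(** * Two-sided linear recurrences *)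

Section Recurrence.
Variable F : fieldType.

Lemma modp_sum (f : {poly F}) n (E : 'I_n -> {poly F}) :
  (\sum_(i < n) E i) %% f = \sum_(i < n) (E i %% f).
Proof. by apply: (big_morph (fun p => p %% f)); [exact: modpD|exact: mod0p]. Qed.

(* Solutions are read off the class of [X^(k/n)] in [F[x]/(f)], where [X] is
   invertible because [f(0) = 1]. *)
Lemma recurrence_solution (f g : {poly F}) (n : nat) :
  f.[0] = 1 -> (0 < n)%N -> ~~ (f %| g) ->
  exists h : int -> F,
    (forall k : int, \sum_(i < size f) f`_i * h (k + (i * n)%N%:Z) = 0) /\
    \sum_(i < size g) g`_i * h (i * n)%N%:Z != 0.
Proof.
move=> f0 n0 fg.
have f00 : f`_0 = 1 by rewrite -horner_coef0.
(* As [f = 1 + X w], the class of [- w] is the inverse of [X] modulo [f]. *)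
pose w : {poly F} := drop_poly 1 f.
have fw : f = 1 + 'X * w.
  apply/polyP => -[|i]; rewrite coefD coef1 coefXM /=; first by rewrite addr0.
  by rewrite add0r coef_drop_poly addn1.
pose u := - w.
have Xu : ('X * u) %% f = 1 %% f.
  apply/eqP; rewrite -subr_eq0 -modpN -modpD /u mulrN -opprD addrC -fw.
  by rewrite modpN modpp oppr0.
(* [P k] represents [X^k] modulo [f]; [Negz a] is the opposite of [a + 1], hence the exponent
   [a.+1]. *)
pose P (k : int) : {poly F} := match k with Posz a => 'X^a | Negz a => u ^+ a.+1 end.
have P1 k : ('X * P k) %% f = P (k + 1) %% f.
  case: k => [a|[|a]]; first by rewrite /P /= addn1 exprS.
    by rewrite {1}/P expr1 Xu.
  have -> : P (Negz a.+1) = u * P (Negz a) by rewrite /P exprS.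
  have -> : Negz a.+1 + 1 = Negz a by rewrite !NegzE -[a.+2]addn1 PoszD opprD addrNK.
  by rewrite mulrA mulrC -modp_mul Xu modp_mul mulr1.
have Pi k i : ('X^i * P k) %% f = P (k + i%:Z) %% f.
  elim: i => [|i IH]; first by rewrite expr0 mul1r addr0.
  rewrite exprS -mulrA -modp_mul IH modp_mul P1; congr (P _ %% f).
  by rewrite -addrA; congr (_ + _); rewrite -addn1.
have PE (q : {poly F}) k :
    \sum_(i < size q) q`_i *: (P (k + i%:Z) %% f) = (q * P k) %% f.
  rewrite -[q in RHS]coefK poly_def mulr_suml modp_sum; apply: eq_bigr => i _.
  by rewrite -scalerAl modpZl Pi.
(* Reading a coefficient where the remainder of [g] is nonzero is the linear form that defines
   [h]. *)
have [j gj] : exists j, (g %% f)`_j != 0.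
  exists (size (g %% f)).-1; rewrite -lead_coefE lead_coef_eq0.
  by move: fg; rewrite /dvdp.
(* Off the multiples of [n], the recurrence of step [n] is solved by zero. *)
pose h k := if (n%:Z %| k)%Z then (P (k %/ n%:Z)%Z %% f)`_j else 0.
have nz0 : n%:Z != 0 by rewrite -lt0n in n0 *.
have hE k i : h (k + (i * n)%N%:Z) =
    if (n%:Z %| k)%Z then (P ((k %/ n%:Z)%Z + i%:Z) %% f)`_j else 0.
  by rewrite /h PoszM rpredDr ?dvdz_mull // addrC divzMDl // addrC.
have sumE (q : {poly F}) k : (n%:Z %| k)%Z ->
    \sum_(i < size q) q`_i * h (k + (i * n)%N%:Z) = ((q * P (k %/ n%:Z)%Z) %% f)`_j.
  move=> nk; rewrite -PE coef_sum; apply: eq_bigr => i _.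
  by rewrite coefZ hE nk.
exists h; split=> [k|].
  have [nk|nk] := boolP (n%:Z %| k)%Z; first by rewrite sumE // modp_mulr coef0.
  by rewrite big1 // => i _; rewrite hE (negbTE nk) mulr0.
have := sumE g 0; rewrite dvdz0 div0z /= mulr1 => /(_ isT) sg.
rewrite (eq_bigr (fun i : 'I__ => g`_i * h (0 + (i * n)%N%:Z))) ?sg //;
by move=> i _; rewrite add0r.
Qed.

End Recurrence.

(** * Exit-free cycles of the quotient digraph *)

Lemma uniq_map_in (T1 T2 : eqType) (f : T1 -> T2) (s : seq T1) :
  uniq (map f s) -> {in s &, injective f}.
Proof.
elim: s => //= a s IH /andP[fa /IH inj] x y /[!inE].
move=> /predU1P[->|xs] /predU1P[->|ys] //; last exact: inj.
  by move=> E; rewrite E map_f in fa.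
by move=> E; rewrite -E map_f in fa.
Qed.

Section Cycles.
Variable G : digraph.
Implicit Types (u v w : vertex G) (e f : arrow G) (p q c : seq (arrow G)).

Lemma rotations_refl p : rotations p p.
Proof. by exists 0%N; rewrite ?rot0. Qed.

Lemma rotations_sym p q : rotations p q -> rotations q p.
Proof.
move=> [n _ <-]; case: (leqP n (size p)) => np.
  by exists (size (rot n p) - n)%N => //; exact: rotK.
by exists 0%N; rewrite // rot0 rot_oversize // ltnW.
Qed.

Lemma rotations_trans p q r : rotations p q -> rotations q r -> rotations p r.
Proof.
move=> [n _ <-] [m _ <-].
case: (leqP n (size p)) => np; last first.
  by exists m; rewrite // (rot_oversize (ltnW np)).
case: (leqP m (size p)) => mp; last first.
  by exists n; rewrite // (rot_oversize (s := rot n p)) // size_rot ltnW.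
by rewrite rot_add_mod //; eexists.
Qed.

Lemma rotations_eq p q : rotations p q -> rotations p = rotations q.
Proof.
move=> pq; apply/seteqP; split=> r.
  by apply: rotations_trans; exact: rotations_sym.
exact: rotations_trans.
Qed.

Lemma geometric_cycle_rotations (C : geometric_cycle G) p :
  sval C p -> sval C = rotations p.
Proof. by case: C => C /= [q _ ->] /rotations_eq. Qed.

Lemma geometric_cycle_eq (C D : geometric_cycle G) p :
  sval C p -> sval D p -> C = D.
Proof.
move=> /geometric_cycle_rotations Cp /geometric_cycle_rotations Dp.
by move: C D Cp Dp => [C HC] [D HD] /= Cp Dp; apply: eq_exist; rewrite Cp.
Qed.

Lemma rot_cycle c n : is_cycle c -> is_cycle (rot n c).
Proof.
move=> [c0 [v cv] uc]; case: (leqP n (size c)) => nc; last first.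
  by rewrite (rot_oversize (ltnW nc)); split=> //; exists v.
split; last by rewrite map_rot rot_uniq.
  by rewrite -size_eq0 size_rot size_eq0.
by have [w ?] := rot_path cv nc; exists w.
Qed.

Lemma geometric_cycle_cycle (C : geometric_cycle G) p : sval C p -> is_cycle p.
Proof. by case: C => C /= [q cq ->] [n _ <-]; exact: rot_cycle. Qed.

Lemma cycle_source v c : c != [::] -> is_path v c v ->
  exists2 e, e \in c & source e = v.
Proof. by case: c => // e c _ [sv _]; exists e; rewrite ?mem_head. Qed.

Lemma cycle_target_source v c e : is_path v c v -> e \in c ->
  exists2 f, f \in c & source f = target e.
Proof.
move=> cv /splitPr ec.
case: ec cv => p q; rewrite -cat_rcons => /is_path_cat[w].
rewrite -{1}cats1 => /is_path_cat[u pu /= [su <-]].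
case: q => [/= tv|f q /= [sf _]]; last first.
  by exists f => //; rewrite mem_cat inE eqxx orbT.
case: p pu => [/= vu|f p /= [sf _]]; first by exists e; rewrite ?inE ?eqxx // su tv.
by exists f; rewrite ?inE ?eqxx ?sf.
Qed.

Lemma cycle_source_target v c e : is_path v c v -> e \in c ->
  exists2 f, f \in c & target f = source e.
Proof.
move=> cv /splitPr ec.
case: ec cv => p q /is_path_cat[u pu /= [se]].
case/lastP: p pu => [|p f]; last first.
  rewrite -cats1 => /is_path_cat[w _ /= [_ tf]] _.
  by exists f; rewrite ?se // mem_cat mem_cat !inE eqxx orbT.
move=> /= vu; case/lastP: q => [/= te|q f]; first by exists e; rewrite ?inE // se te.
rewrite -cats1 => /is_path_cat[w _ /= [_ tf]].
by exists f; rewrite ?se -?vu // cats1 inE mem_rcons inE eqxx orbT.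
Qed.

End Cycles.

Section ExitFree.
Variables (G : digraph) (P : admissible_pair G).
Implicit Types (u v : vertex G) (e f : arrow G) (c : seq (arrow G)).
Local Notation H := (ap_H P).
Local Notation S := (ap_S P).
Local Notation D := (quotient_digraph P).

(* The vertices of [G] outside [H] that are regular in the quotient digraph. *)
Definition quotient_regular v : Prop :=
  [/\ finite_set (out_arrows_avoiding H v), out_arrows_avoiding H v !=set0
    & ~ (breaking H `\` S) v].

(* The exit-free cycles of the quotient digraph, described in [G]. *)
Definition exit_free c : Prop :=
  is_cycle c /\ forall e, e \in c ->
    [/\ ~ H (target e), quotient_regular (source e) &
        forall f, source f = source e -> ~ H (target f) -> f = e].

Lemma exit_free_rot c n : exit_free c -> exit_free (rot n c).
Proof. by move=> [cc ec]; split=> [|e]; [exact: rot_cycle|rewrite mem_rot => /ec]. Qed.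

(* Retyped so that the [eqType] found is that of [arrow D], not of the sum type. *)
Definition base_arrow (e : arrow D) : arrow G := underlying_arrow e.
Local Notation und := base_arrow.

Definition unprimed (e : arrow D) : bool := if e is inl _ then true else false.

Lemma cycle_unprimed (p : seq (arrow D)) (v : vertex D) : is_path v p v ->
  all unprimed p.
Proof.
move=> pv; apply/allP => e ep.
have [f _] := cycle_target_source pv ep.
by case: e {ep} => [//|e] /=.
Qed.

Lemma underlying_arrow_inj (e f : arrow D) : unprimed e -> unprimed f ->
  und e = und f -> e = f.
Proof. by case: e => // e; case: f => // f _ _ /= /val_inj ->. Qed.

Lemma underlying_source (e : arrow D) : underlying_vertex (source e) = source (und e).
Proof. by []. Qed.

Lemma underlying_target (e : arrow D) : underlying_vertex (target e) = target (und e).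
Proof. by case: e. Qed.

Lemma underlying_path (v : vertex D) (p : seq (arrow D)) (w : vertex D) : is_path v p w ->
  is_path (underlying_vertex v) (map und p) (underlying_vertex w).
Proof.
by elim: p v => [|e p IH] v /= => [->//|[<- /IH]]; rewrite underlying_target.
Qed.

Lemma source_inj (e f : arrow D) : source (und e) = source (und f) -> source e = source f.
Proof.
by move=> ef; apply: (congr1 (@inl _ _)); apply: eq_exist. Qed.

Lemma avoiding_arrow e (He : ~ H (target e)) : exists2 f : arrow D, unprimed f & und f = e.
Proof. by exists (inl (exist _ e (mem_set He))). Qed.

Lemma no_exit_exit_free (C : geometric_cycle D) (p : seq (arrow D)) : no_exit C -> sval C p ->
  exit_free (map und p).
Proof.
move=> nC Cp; have cp := geometric_cycle_cycle Cp; have [p0 [v pv] up] := cp.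
have /allP inlp := cycle_unprimed pv.
(* Without exits, every arrow issued from a source of the cycle lies on the cycle. *)
have nx (e : arrow D) : (exists2 f, f \in p & source e = source f) -> e \in p.
  move=> [f fp ef]; apply/negPn/negP => ep; apply: (nC p Cp e); split=> //.
  by exists f => //; left.
have uniqs (e f : arrow D) : e \in p -> f \in p -> source e = source f -> e = f.
  by move=> ep fp; exact: (uniq_map_in up).
split.
  split; first by rewrite -size_eq0 size_map size_eq0.
    by exists (underlying_vertex v); exact: underlying_path.
  rewrite -map_comp (eq_map (g := (@underlying_vertex G P) \o @source D)) //.
  rewrite map_comp (@map_inj_in_uniq (vertex D) (vertex G)); first exact: up.
  by move=> x y /mapP[e _ ->] /mapP[f _ ->] /source_inj.
move=> _ /mapP[e ep ->].
(* If the cycle entered a vertex of [breaking H] outside [S], the primed copy of the entering arrow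
   would be an exit. *)
have tnB x : x \in p -> ~ (breaking H `\` S) (target (und x)).
  move=> xp Bx.
  have := inlp (inr (exist _ (und x) (mem_set Bx)) : arrow D).
  by rewrite nx //; [move=> /(_ isT)|exists x => //; exact: source_inj].
have nH x : x \in p -> ~ H (target (und x)).
  by move=> /inlp; case: x => // -[x /= /set_mem].
have un f : source f = source (und e) -> ~ H (target f) -> f = und e.
  move=> fe /avoiding_arrow[g ug gf]; rewrite -gf; congr und.
  have sge : source g = source e by apply: source_inj; rewrite gf.
  by apply: uniqs => //; apply: nx; exists e.
split=> //; first exact: nH.
have Eav : out_arrows_avoiding H (source (und e)) = [set und e].
  apply/seteqP; split=> [f [/= sf tf]|_ ->]; first exact: un.
  by split=> //; exact: nH.
split; rewrite ?Eav //; first by exists (und e).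
have [g gp tg] := cycle_source_target pv ep.
by rewrite -underlying_source -tg underlying_target; exact: tnB.
Qed.

Lemma unprimed_target (e : arrow D) : unprimed e -> ~ H (target (und e)).
Proof. by case: e => // -[e /= /set_mem]. Qed.

Lemma primed_target (e : arrow D) : ~~ unprimed e -> (breaking H `\` S) (target (und e)).
Proof. by case: e => // -[e /= /set_mem]. Qed.

Definition kept (v : vertex D) : bool := if v is inl _ then true else false.

Lemma kept_inj (v w : vertex D) : kept v -> kept w ->
  underlying_vertex v = underlying_vertex w -> v = w.
Proof. by case: v => // v; case: w => // w _ _ /= /val_inj ->. Qed.

Lemma lift_path u c w (v : vertex D) : (forall e, e \in c -> ~ H (target e)) ->
  is_path u c w -> kept v -> underlying_vertex v = u ->
  exists (p : seq (arrow D)) (w' : vertex D), [/\ is_path v p w', all unprimed p, map und p = c, kept w'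
                 & underlying_vertex w' = w].
Proof.
elim: c u v => [|e c IH] u v cH /=; first by move=> <- kv vu; exists [::], v.
move=> [se cw] kv vu; have eH : ~ H (target e) by apply: cH; rewrite mem_head.
pose a : arrow D := inl (exist _ e (mem_set eH)).
have [||//|//|p [w' [pw' up mp kw' ww']]] := IH (target e) (target a).
- by move=> f fc; apply: cH; rewrite inE fc orbT.
- exact: cw.
exists (a :: p), w'; split=> //=; last by rewrite mp.
split=> //; apply: kept_inj => //; by rewrite vu.
Qed.

Lemma exit_free_no_exit c : exit_free c ->
  exists C : geometric_cycle D, no_exit C /\
    exists2 p : seq (arrow D), sval C p & map und p = c.
Proof.
move=> [[c0 [v cv] uc] cP].
have [e ec] : exists e, e \in c by case: (c) c0 => // e c' _; exists e; rewrite mem_head.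
have vH : ~ H v.
  move: c0 cv cP; case: (c) => // a c' _ /= [<- _] cP Ha.
  have [+ _ _] := cP a (mem_head _ _); apply.
  exact: (@ap_hereditary _ P (source a) _ [:: a] Ha).
pose v' : vertex D := inl (exist _ v (mem_set vH)).
have [||//|//|p [w [pw up mp kw vw]]] := @lift_path v c v v'.
- by move=> f /cP[].
- exact: cv.
have wv : w = v' by exact: kept_inj.
subst w; clear kw vw.
have cp : is_cycle p.
  split; first by rewrite -size_eq0 -(size_map und) mp size_eq0.
    by exists v'.
  have : uniq (map (@underlying_vertex G P) (map (@source D) p)).
    by rewrite -map_comp; move: uc; rewrite -mp -map_comp.
  exact: (@map_uniq (vertex D) (vertex G)).
have mem_und (x : arrow D) : x \in p -> und x \in c by rewrite -mp; exact: map_f.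
exists (exist _ (rotations p) (ex_intro2 _ _ p cp erefl)); split; last first.
  by exists p => //; exact: rotations_refl.
move=> q /= [n _ <-] {q} a [].
rewrite mem_rot => ap [e1]; rewrite mem_rot => e1p se1; apply/negP: ap.
have [f fp sf] : exists2 f, f \in p & source (a : arrow D) = source f.
  case: se1 => [->|->]; first by exists e1.
  by have [f fp <-] := cycle_target_source pw e1p; exists f.
have [_ _ uf] := cP _ (mem_und _ fp).
have auf : ~ H (target (und a)) -> und a = und f.
  by apply: uf; rewrite -!underlying_source sf.
apply/negPn; have [ua|/primed_target Ba] := boolP (unprimed a).
  suff -> : (a : arrow D) = f by [].
  apply: underlying_arrow_inj (ua) _ (auf (unprimed_target ua)).
  by move/allP: up => /(_ _ fp).
(* A primed [a] lies over [f], so the target of [f] is breaking and outside [S]; but that target is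
   the source of an arrow [y] of [c], hence regular in the quotient. *)
have [y yc sy] := cycle_target_source cv (mem_und _ fp).
have [_ [_ _]] := cP _ yc; rewrite sy -auf //.
by case: Ba => /breaking_notin.
Qed.

Lemma map_base_arrow_inj (C1 C2 : geometric_cycle D) (p1 p2 : seq (arrow D)) :
  sval C1 p1 -> sval C2 p2 -> map und p1 = map und p2 -> C1 = C2.
Proof.
move=> Cp1 Cp2 e12; suff E : p1 = p2 by rewrite -E in Cp2; exact: geometric_cycle_eq Cp2.
have [_ [v1 /cycle_unprimed u1] _] := geometric_cycle_cycle Cp1.
have [_ [v2 /cycle_unprimed u2] _] := geometric_cycle_cycle Cp2.
elim: p1 p2 e12 u1 u2 {Cp1 Cp2} => [|a p1 IH] [|b p2] //= [ab p12] /andP[ua u1] /andP[ub u2].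
by rewrite (IH _ p12) // (underlying_arrow_inj ua ub ab).
Qed.

End ExitFree.

Lemma admissible_pair_eq (G : digraph) (P Q : admissible_pair G) :
  ap_H P = ap_H Q -> ap_S P = ap_S Q -> P = Q.
Proof.
case: P Q => [H S h s b] [H' S' h' s' b'] /= eH eS; subst H' S'.
by congr AdmissiblePair; exact: Prop_irrelevance.
Qed.

(** * Quadruples read on cycles of the digraph itself *)

Section FlatData.
Variables (F : fieldType) (G : digraph).
Implicit Types (q : quadruple F G) (c : seq (arrow G)) (f : {poly F}).

(* The function [quad_theta q], read on the cycles of [G] that represent the
   geometric cycles in [quad_beta q]. *)
Definition theta_rel q c f : Prop :=
  exists (C : quad_beta q) (p : seq (arrow (quotient_digraph (quad_pair q)))),
    [/\ sval (val C) p, map (@base_arrow G (quad_pair q)) p = c & val (quad_theta q C) = f].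

Lemma theta_rel_exit_free q c f : theta_rel q c f -> exit_free (quad_pair q) c.
Proof.
move=> [C [p [Cp <- _]]]; apply: no_exit_exit_free Cp.
by apply: quad_beta_no_exit; exact: set_mem (valP C).
Qed.

Lemma theta_rel_poly q c f : theta_rel q c f -> (1 < size f)%N /\ f.[0] = 1.
Proof. by move=> [C [p [_ _ <-]]]; case: (quad_theta q C) => g /= /andP[? /eqP]. Qed.

Lemma theta_rel_fun q c f g : theta_rel q c f -> theta_rel q c g -> f = g.
Proof.
move=> [C [p [Cp <- <-]]] [D [p' [Dp' pp' <-]]].
by have /val_inj-> := map_base_arrow_inj Cp Dp' (esym pp').
Qed.

Lemma theta_rel_rot q c f n : theta_rel q c f -> theta_rel q (rot n c) f.
Proof.
move=> [C [p [Cp <- <-]]]; exists C, (rot n p); split=> //; last by rewrite map_rot.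
by rewrite (geometric_cycle_rotations Cp); exists n.
Qed.

(** The types of [quad_beta] and [quad_theta] depend on [quad_pair]. Comparing the relations
    [theta_rel], whose type is fixed, avoids any transport between them. *)
Lemma quadruple_eq q1 q2 :
  ap_H (quad_pair q1) = ap_H (quad_pair q2) ->
  ap_S (quad_pair q1) = ap_S (quad_pair q2) ->
  (forall c f, theta_rel q1 c f -> theta_rel q2 c f) ->
  (forall c f, theta_rel q2 c f -> theta_rel q1 c f) -> q1 = q2.
Proof.
case: q1 q2 => [P B1 n1 x1 t1] [P2 B2 n2 x2 t2] /= eH eS.
have eP : P = P2 by exact: admissible_pair_eq.
subst P2 => sub12 sub21 {eH eS}.
have rep (C : geometric_cycle (quotient_digraph P)) : exists p, sval C p.
  by case: C => C /= [p _ ->]; exists p; exact: rotations_refl.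
have B12 : B1 = B2.
  apply/seteqP; split=> C BC; have [p Cp] := rep C.
    have [|[D BD] [p' [/= Dp' pp' _]]] := sub12 (map (@base_arrow G P) p) (val (t1 (exist _ C (mem_set BC)))).
      by exists (exist _ C (mem_set BC)), p.
    by rewrite (map_base_arrow_inj Cp Dp' (esym pp')); exact: set_mem.
  have [|[D BD] [p' [/= Dp' pp' _]]] := sub21 (map (@base_arrow G P) p) (val (t2 (exist _ C (mem_set BC)))).
    by exists (exist _ C (mem_set BC)), p.
  by rewrite (map_base_arrow_inj Cp Dp' (esym pp')); exact: set_mem.
subst B2; rewrite (Prop_irrelevance n2 n1) (Prop_irrelevance x2 x1).
congr Quadruple; apply: funext => C; apply: val_inj.
have [p Cp] := rep (val C).
have [|D [p' [/= Dp' pp' <-]]] := sub12 (map (@base_arrow G P) p) (val (t1 C)).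
  by exists C, p.
by have /val_inj -> := map_base_arrow_inj Cp Dp' (esym pp').
Qed.

End FlatData.

(** * A graded module on boundary paths *)

Section Action.
Variables (F : fieldType) (G : digraph) (P : admissible_pair G).
Local Notation L := (lpa F G).
Local Notation H := (ap_H P).
Local Notation S := (ap_S P).
Implicit Types (u v w : vertex G) (e f : arrow G) (c : seq (arrow G)).

(* A boundary path of the quotient digraph: [x k] is the vertex reached after
   [k] steps, with the next arrow; once [None] is met, the path is over and [x]
   is constant. *)
Definition stream : Type := nat -> vertex G * option (arrow G).
Implicit Types x y : stream.

(** At a breaking vertex outside [S] a path may go on or stop, since such a vertex is not
    [quotient_regular]: stopping there stands for ending at its primed copy. The other vertices
    where a path may stop are those that emit no arrow, or infinitely many, towards the complement
    of [H]. *)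
Definition boundary_path x : Prop :=
  ~ H (x 0%N).1 /\ forall k, if (x k).2 is Some e
    then [/\ source e = (x k).1, target e = (x k.+1).1 & ~ H (target e)]
    else ~ quotient_regular P (x k).1 /\ x k.+1 = x k.

Definition shift x : stream := fun k => x k.+1.
Definition scons e x : stream := fun k => if k is k'.+1 then x k' else (source e, Some e).

Lemma boundary_shift x : boundary_path x -> boundary_path (shift x).
Proof.
move=> [x0 xk]; split; last by move=> k; exact: xk.
by have := xk 0%N; rewrite /shift; case: (x 0%N).2 => [e [_ <-]//|[_ ->]].
Qed.

Lemma hereditary_arrow e : H (source e) -> H (target e).
Proof. by move=> He; exact: (@ap_hereditary _ P (source e) _ [:: e] He). Qed.

Lemma boundary_scons e x : boundary_path x -> (x 0%N).1 = target e ->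
  boundary_path (scons e x).
Proof.
move=> [x0 xk] xe; split; first by move=> /= /hereditary_arrow; rewrite -xe.
by case=> [|k]; [rewrite /= -xe|exact: xk].
Qed.

Lemma boundary_head e x : boundary_path x -> (x 0%N).2 = Some e ->
  [/\ source e = (x 0%N).1, target e = (shift x 0%N).1 & ~ H (target e)].
Proof. by move=> [_ /(_ 0%N)] + xe; rewrite xe. Qed.

Lemma scons_shift e x : boundary_path x -> (x 0%N).2 = Some e -> scons e (shift x) = x.
Proof.
move=> bx xe; apply: funext => -[|k] //=; have [-> _ _] := boundary_head bx xe.
by rewrite -xe -surjective_pairing.
Qed.

(* Functions on boundary paths, with a degree: the action of an arrow shifts
   the degree by one, so that a power of an exit-free cycle acts on its infinite
   path as a translation of [int]. *)
Definition fmod : Type := stream -> int -> F.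
Implicit Types m : fmod.

(** Functions are pulled back: an arrow evaluates them on the path deprived of its first arrow, a
    ghost arrow on the path extended by one. Defined on terms, the action passes to the algebra by
    [term_act_cong]. *)
Fixpoint term_act (t : lpa_term F G) m : fmod :=
  match t with
  | TVertex v => fun x k =>
      if `[< boundary_path x /\ (x 0%N).1 = v >] then m x k else 0
  | TArrow e => fun x k =>
      if `[< boundary_path x /\ (x 0%N).2 = Some e >] then m (shift x) (k + 1) else 0
  | TGhost e => fun x k =>
      if `[< boundary_path x /\ (x 0%N).1 = target e >] then m (scons e x) (k - 1) else 0
  | TZero => fun x k => 0
  | TAdd a b => fun x k => term_act a m x k + term_act b m x k
  | TScale l a => fun x k => l * term_act a m x k
  | TMul a b => term_act a (term_act b m)
  end.

Lemma term_act_linear t l m m' :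
  term_act t (fun x k => l * m x k + m' x k) =
  fun x k => l * term_act t m x k + term_act t m' x k.
Proof.
elim: t l m m' => [v|e|e||a IHa b IHb|z a IHa|a IHa b IHb] l m m'; apply: funext => x;
  apply: funext => k /=; try (by case: ifP => _; rewrite ?mulr0 ?addr0).
- by rewrite mulr0 addr0.
- by rewrite IHa IHb mulrDr addrACA.
- by rewrite IHa mulrDr mulrCA.
- by rewrite IHb IHa.
Qed.

Lemma fmodE (m m' : fmod) : (forall x k, m x k = m' x k) -> m = m'.
Proof. by move=> mm; apply: funext => x; apply: funext => k. Qed.

Lemma term_actD t m m' :
  term_act t (fun x k => m x k + m' x k) =
  fun x k => term_act t m x k + term_act t m' x k.
Proof.
have := term_act_linear t 1 m m'.
under eq_fun do under eq_fun do rewrite mul1r.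
by move=> ->; apply: fmodE => x k; rewrite mul1r.
Qed.

Lemma term_act0 t : term_act t (fun _ _ => 0) = fun _ _ => 0.
Proof.
have := term_act_linear t (-1) (fun _ _ => 0) (fun _ _ => 0).
under eq_fun do under eq_fun do rewrite mulr0 addr0.
by move=> ->; apply: fmodE => x k; rewrite mulN1r addNr.
Qed.

Lemma term_actZ t l m :
  term_act t (fun x k => l * m x k) = fun x k => l * term_act t m x k.
Proof.
have := term_act_linear t l m (fun _ _ => 0).
under eq_fun do under eq_fun do rewrite addr0.
by move=> ->; apply: fmodE => x k; rewrite term_act0 addr0.
Qed.

Lemma term_act_arrow_ghost e m :
  term_act (TMul (TArrow F e) (TGhost F e)) m =
  fun x k => if `[< boundary_path x /\ (x 0%N).2 = Some e >] then m x k else 0.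
Proof.
apply: fmodE => x k /=; case: asboolP => // -[bx xe]; case: asboolP => [_|].
  by rewrite scons_shift // addrK.
by case; split; [exact: boundary_shift|have [_ ->] := boundary_head bx xe].
Qed.

Lemma term_act_sum (I : Type) (r : seq I) (E : I -> lpa_term F G) m x k :
  term_act (\big[@TAdd F G/@TZero F G]_(i <- r) E i) m x k =
  \sum_(i <- r) term_act (E i) m x k.
Proof. by elim: r => [|i r IH]; rewrite ?big_nil ?big_cons //= IH. Qed.

(** Saturation yields an arrow that avoids [H], and a finite emitter is never breaking. *)
Lemma regular_quotient_regular v : finite_set (out_arrows v) -> out_arrows v !=set0 ->
  ~ H v -> quotient_regular P v.
Proof.
move=> fv v0 vH; split; first by apply: sub_finite_set fv => e [].
  have [E|/set0P//] := eqVneq (out_arrows_avoiding H v) set0; case: vH; apply: (@ap_saturated _ P v fv v0).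
  move=> _ [e ev <-]; apply: contrapT => eH.
  by have : out_arrows_avoiding H v e by []; rewrite E.
by case=> -[].
Qed.

Lemma term_act_cong a b : lpa_cong a b -> term_act a = term_act b.
Proof.
elim=> {a b} //=.
- by move=> a b c _ -> _ ->.
- by move=> a a' b b' _ -> _ ->.
- by move=> k a a' _ ->.
- by move=> a a' b b' _ -> _ ->.
- by move=> a b c; apply: funext => m; apply: fmodE => x k; rewrite addrA.
- by move=> a b; apply: funext => m; apply: fmodE => x k; rewrite addrC.
- by move=> a; apply: funext => m; apply: fmodE => x k; rewrite add0r.
- by move=> a; apply: funext => m; apply: fmodE => x k; rewrite mulN1r addNr.
- by move=> k l a; apply: funext => m; apply: fmodE => x j; rewrite mulrA.
- by move=> a; apply: funext => m; apply: fmodE => x j; rewrite mul1r.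
- by move=> k a b; apply: funext => m; apply: fmodE => x j; rewrite mulrDr.
- by move=> k l a; apply: funext => m; apply: fmodE => x j; rewrite mulrDl.
- by move=> a b c; apply: funext => m; rewrite term_actD.
- by move=> k a b; apply: funext => m; rewrite term_actZ.
- by move=> v; apply: funext => m; apply: fmodE => x j; case: asboolP.
- move=> u v uv; apply: funext => m; apply: fmodE => x j.
  by case: asboolP => // -[_ xu]; case: asboolP => // -[_ xv]; case: uv; rewrite -xu.
- move=> e; apply: funext => m; apply: fmodE => x j; case: asboolP => // nb.
  case: asboolP => // -[bx xe]; case: nb; split=> //.
  by have [-> _ _] := boundary_head bx xe.
- move=> e; apply: funext => m; apply: fmodE => x j; case: asboolP => // -[bx xe].
  case: asboolP => // -[]; split; first exact: boundary_shift.
  by have [_ ->] := boundary_head bx xe.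
- by move=> e; apply: funext => m; apply: fmodE => x j; case: asboolP.
- move=> e; apply: funext => m; apply: fmodE => x j; case: asboolP => // -[bx xe].
  by case: asboolP => // -[]; split=> //; exact: boundary_scons.
- move=> e; apply: funext => m; apply: fmodE => x j; case: asboolP => // -[bx xe].
  case: asboolP => [_|]; first by rewrite subrK.
  by case; split=> //; exact: boundary_scons.
- move=> e f ef; apply: funext => m; apply: fmodE => x j; case: asboolP => // -[bx xe].
  by case: asboolP => // -[_ /= [] /ef].
- move=> v fv v0; apply: funext => m; apply: fmodE => x j; rewrite term_act_sum.
  under eq_bigr do rewrite term_act_arrow_ghost.
  case: asboolP => [[bx xv]|nb]; last first.
    rewrite big_seq big1 // => e; rewrite in_fset_set // => /set_mem /= ev.
    case: asboolP => // -[bx xe]; case: nb; split=> //.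
    by have [<- _ _] := boundary_head bx xe.
  (* No boundary path stops at the regular vertex [v], so exactly one summand of (CK2), given by the
     first arrow, acts on [x] as the identity. *)
  case xe: (x 0%N).2 => [e|]; last first.
    have [xH /(_ 0%N)] := bx; rewrite xe => -[nr _]; case: nr; rewrite xv.
    by apply: regular_quotient_regular => //; rewrite -xv.
  have ev : e \in fset_set (out_arrows v).
    rewrite in_fset_set //; apply: mem_set; rewrite -xv.
    by have [se _ _] := boundary_head bx xe; exact: se.
  rewrite (bigD1_seq e) ?fset_uniq //= asboolT // big1 ?addr0 // => f /eqP fe.
  by rewrite asboolF // => -[_ [ef]]; exact: fe.
Qed.

Definition act (a : L) : fmod -> fmod := term_act (repr a).

Lemma act_pi t : act (\pi_(lpa F G) t) = term_act t.
Proof. by rewrite /act; apply: term_act_cong; exact: lpa_repr_pi. Qed.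

Lemma act_vertex v m x k : act (lpa_vertex F v) m x k =
  if `[< boundary_path x /\ (x 0%N).1 = v >] then m x k else 0.
Proof. by rewrite act_pi. Qed.
Lemma act_arrow e m x k : act (lpa_arrow F e) m x k =
  if `[< boundary_path x /\ (x 0%N).2 = Some e >] then m (shift x) (k + 1) else 0.
Proof. by rewrite act_pi. Qed.
Lemma act_ghost e m x k : act (lpa_ghost F e) m x k =
  if `[< boundary_path x /\ (x 0%N).1 = target e >] then m (scons e x) (k - 1) else 0.
Proof. by rewrite act_pi. Qed.
Lemma act0 m x k : act 0 m x k = 0.
Proof. by rewrite act_pi. Qed.
Lemma actD a b m x k : act (a + b) m x k = act a m x k + act b m x k.
Proof. by rewrite [a + b]/(lpa_add a b) act_pi. Qed.
Lemma actZ l a m x k : act (l *: a) m x k = l * act a m x k.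
Proof. by rewrite [l *: a]/(lpa_scale l a) act_pi. Qed.
Lemma actM a b m : act (a ** b) m = act a (act b m).
Proof. by rewrite act_pi. Qed.
Lemma act_f0 a x k : act a (fun _ _ => 0) x k = 0.
Proof. by rewrite /act term_act0. Qed.
Lemma act_sum (I : Type) (r : seq I) (Q : pred I) (E : I -> L) m x k :
  act (\sum_(i <- r | Q i) E i) m x k = \sum_(i <- r | Q i) act (E i) m x k.
Proof.
apply: (big_morph (fun a => act a m x k)); last exact: act0.
by move=> a b; exact: actD.
Qed.
Lemma actB a b m x k : act (a - b) m x k = act a m x k - act b m x k.
Proof. by rewrite actD -scaleN1r actZ mulN1r. Qed.

Lemma act_arrow_ghost e m x k : act (lpa_arrow F e ** lpa_ghost F e) m x k =
  if `[< boundary_path x /\ (x 0%N).2 = Some e >] then m x k else 0.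
Proof.
by rewrite lpa_mulE act_pi term_act_arrow_ghost.
Qed.

End Action.

(** * Boundary paths that meet exit-free cycles *)

Section Follow.
Variables (G : digraph) (P : admissible_pair G).
Local Notation H := (ap_H P).
Local Notation S := (ap_S P).
Implicit Types (u v w : vertex G) (e f : arrow G) (c d p : seq (arrow G)).
Implicit Types x y : stream G.

Definition shiftn n x : stream G := fun k => x (n + k)%N.

Lemma shiftn_shift n x : shiftn n (shift x) = shiftn n.+1 x.
Proof. by apply: funext => k; rewrite /shift /shiftn addSn. Qed.

Lemma boundary_shiftn n x : boundary_path P x -> boundary_path P (shiftn n x).
Proof.
elim: n x => [|n IH] x; first exact: id.
by move=> /boundary_shift/IH; rewrite shiftn_shift.
Qed.

Lemma boundary_notin x : boundary_path P x -> ~ H (x 0%N).1.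
Proof. by case. Qed.

(** One choice is made for each vertex: an arrow that avoids [H] if the vertex is regular in the
    quotient, a stop otherwise. *)
Lemma boundary_exists v : ~ H v -> exists2 x, boundary_path P x & (x 0%N).1 = v.
Proof.
move=> vH; have /choice[nx nxP] : forall w, exists o, if o is Some e
    then out_arrows_avoiding H w e else ~ quotient_regular P w.
  move=> w; have [[_ [e we] _]|nw] := pselect (quotient_regular P w).
    by exists (Some e).
  by exists None.
pose s := fix s k := if k is k'.+1
  then if nx (s k') is Some e then target e else s k' else v.
exists (fun k => (s k, nx (s k))) => //; split=> //= k.
have := nxP (s k); case E: (nx (s k)) => [e|] /=; first by case.
by move=> nr; split=> //; rewrite E.
Qed.

(* [x] reaches the exit-free cycle [c], hence eventually follows it forever. *)
Definition reaches x c : Prop := exists N e, e \in c /\ (x N).1 = source e.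

Lemma exit_free_notin v c : exit_free P c -> is_path v c v -> ~ H v.
Proof.
move=> [[c0 _ _] cP] cv; have [e ec <-] := cycle_source c0 cv.
by move=> /hereditary_arrow; have [] := cP e ec.
Qed.

(** Regularity of the source forbids stopping, and the absence of exits forbids leaving the
    cycle. *)
Lemma exit_free_step x c k e : boundary_path P x -> exit_free P c ->
  e \in c -> (x k).1 = source e -> (x k).2 = Some e /\ (x k.+1).1 = target e.
Proof.
move=> [_ /(_ k)] + [_ cP] ec xk; have [_ re ue] := cP _ ec.
case: (x k).2 => [f [sf tf fH]|[]]; last by rewrite xk.
by rewrite (ue f) in tf *; rewrite ?sf.
Qed.

Lemma exit_free_stay x c k l : boundary_path P x -> exit_free P c -> (k <= l)%N ->
  (exists2 e, e \in c & (x k).1 = source e) ->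
  exists2 e, e \in c & (x l).1 = source e.
Proof.
move=> bx cP /subnK <-; elim: (l - k)%N => // j IH xk.
have [e ec xe] := IH xk; have [_ ->] := exit_free_step bx cP ec xe.
have [[_ [v cv] _] _] := cP; have [f fc ft] := cycle_target_source cv ec.
by exists f.
Qed.

Lemma exit_free_unique x y c e : boundary_path P x -> boundary_path P y ->
  exit_free P c -> e \in c -> (x 0%N).1 = source e -> (y 0%N).1 = source e -> x = y.
Proof.
move=> bx by_ cP ec xe ye; have xy k : (x k).1 = (y k).1.
  elim: k => [|k IH]; first by rewrite xe ye.
  have [f fc xf] := exit_free_stay bx cP (leq0n k) (ex_intro2 _ _ e ec xe).
  have [_ ->] := exit_free_step bx cP fc xf.
  by have [_ ->] := exit_free_step by_ cP fc (etrans (esym IH) xf).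
apply: funext => k; move: (xy k).
have [f fc xf] := exit_free_stay bx cP (leq0n k) (ex_intro2 _ _ e ec xe).
have [+ _] := exit_free_step bx cP fc xf.
have [+ _] := exit_free_step by_ cP fc (etrans (esym (xy k)) xf).
by case: (x k) (y k) => [a b] [a' b'] /= -> -> ->.
Qed.

Lemma path_prefix p d u w w' :
  (forall e f, e \in p -> f \in d -> source f = source e -> f = e) ->
  is_path u p w -> is_path u d w' -> (size p <= size d)%N ->
  exists2 q, d = p ++ q & is_path w q w'.
Proof.
elim: p d u => [|a p IH] [|b d] u uq //=; first by move=> ->; exists [::].
  by move=> -> dw _; exists (b :: d).
move=> [sa pw] [sb dw] pd; have ab : b = a by apply: uq; rewrite ?mem_head ?sa.
subst b; have [|q -> qw] := IH d (target a) _ pw dw pd; last by exists q.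
by move=> e f ep fd; apply: uq; rewrite inE ?ep ?fd orbT.
Qed.

(** The shorter cycle is a prefix of the longer one; a proper prefix would make the longer one leave
    [v] twice. *)
Lemma exit_free_size c d v : exit_free P c -> exit_free P d ->
  is_path v c v -> is_path v d v -> (size c <= size d)%N -> c = d.
Proof.
move=> [[c0 _ _] cP] [[_ _ ud] dP] cv dv cd.
have uq e f : e \in c -> f \in d -> source f = source e -> f = e.
  by move=> /cP[_ _ ue] /dP[fH _ _] fe; apply: ue.
have [[|a q] dE qv] := path_prefix uq cv dv cd; first by rewrite dE cats0.
move: ud cv qv; rewrite dE; case: (c) c0 => // b c' _.
rewrite map_cat cat_uniq => /and3P[_ /negP nh _] /= [sb _] [sa _].
case: nh; apply/hasP; exists (source a); first exact: mem_head.
by rewrite /= inE sa sb eqxx.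
Qed.

Lemma exit_free_eq c d v : exit_free P c -> exit_free P d ->
  is_path v c v -> is_path v d v -> c = d.
Proof.
move=> cP dP cv dv; case/orP: (leq_total (size c) (size d)) => cd.
  exact: exit_free_size cP dP cv dv cd.
exact/esym/(exit_free_size dP cP dv cv cd).
Qed.

(** From some common time on, the path follows both cycles, which therefore share an arrow. Hence at
    most one polynomial is imposed on a given path. *)
Lemma reaches_rotations x c d : boundary_path P x -> exit_free P c -> exit_free P d ->
  reaches x c -> reaches x d -> rotations c d.
Proof.
move=> bx cP dP [N [e [ec xe]]] [N' [e' [ec' xe']]].
have [f fc xf] := exit_free_stay bx cP (leq_addr N' N) (ex_intro2 _ _ e ec xe).
have [g gd xg] := exit_free_stay bx dP (leq_addl N N') (ex_intro2 _ _ e' ec' xe').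
have fg : g = f.
  have [_ uc] := cP; have [_ _] := uc _ fc; apply; first by rewrite -xf -xg.
  by have [_ /(_ _ gd)[]] := dP.
subst g; have [i c' cE] := rot_to fc; have [j d' dE] := rot_to gd.
have cP' := exit_free_rot i cP; have dP' := exit_free_rot j dP.
have loop a q : exit_free P (a :: q) -> is_path (source a) (a :: q) (source a).
  by move=> [[_ [v aq] _] _]; have [av aq'] := aq; split=> //; rewrite av.
rewrite cE in cP'; rewrite dE in dP'.
have E := exit_free_eq cP' dP' (loop _ _ cP') (loop _ _ dP').
apply: (@rotations_trans _ _ (rot i c)); first by exists i.
by apply: rotations_sym; rewrite cE E -dE; exists j.
Qed.

End Follow.

(** * Vertices, cycles and degrees in the ideal of a quadruple *)

Section Submodule.
Variables (F : fieldType) (G : digraph) (q : quadruple F G).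
Local Notation P := (quad_pair q).
Local Notation L := (lpa F G).
Local Notation H := (ap_H P).
Local Notation S := (ap_S P).
Local Notation fmod := (fmod F G).
Implicit Types (u v w : vertex G) (e f : arrow G) (c d p : seq (arrow G)).
Implicit Types x y : stream G.
Implicit Types m : fmod.

Lemma reaches_shift x c : boundary_path P x -> exit_free P c ->
  reaches x c -> reaches (shift x) c.
Proof.
move=> bx cP [N [e [ec xe]]].
have [f fc xf] := exit_free_stay bx cP (leqnSn N) (ex_intro2 _ _ e ec xe).
by exists N, f.
Qed.

Definition recurrence (h : int -> F) x : Prop :=
  forall c g, theta_rel q c g -> reaches x c ->
  forall k : int, \sum_(i < size g) g`_i * h (k + (i * size c)%N%:Z) = 0.

Definition recurrent m : Prop := forall x, boundary_path P x -> recurrence (m x) x.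

(** The recurrence is invariant under translation of the degree and depends only on the tail of the
    path, while arrows and ghost arrows change the first arrow and translate the degree by one. *)
Lemma act_recurrent (a : L) m : recurrent m -> recurrent (act P a m).
Proof.
rewrite /act; elim: (repr a) m => {a} [v|e|e||a IHa b IHb|l a IHa|a IHa b IHb] m mP
  x bx c g cg xc k /=.
- case: asboolP => _; first exact: mP.
  by rewrite big1 // => i _; rewrite mulr0.
- case: asboolP => [[_ xe]|_]; last by rewrite big1 // => i _; rewrite mulr0.
  rewrite -[RHS](mP (shift x) (boundary_shift bx) c g cg _ (k + 1)).
    by apply: eq_bigr => i _; rewrite addrAC.
  by apply: reaches_shift => //; exact: theta_rel_exit_free cg.
- case: asboolP => [[_ xe]|_]; last by rewrite big1 // => i _; rewrite mulr0.
  rewrite -[RHS](mP (scons e x) (boundary_scons bx xe) c g cg _ (k - 1)).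
    by apply: eq_bigr => i _; rewrite addrAC.
  by move: xc => [N [f fP]]; exists N.+1, f.
- by rewrite big1 // => i _; rewrite mulr0.
- under eq_bigr do rewrite mulrDr.
  by rewrite big_split /= (IHa _ mP) // (IHb _ mP) // addr0.
- under eq_bigr do rewrite mulrCA.
  by rewrite -mulr_sumr (IHa _ mP) // mulr0.
- exact: (IHa _ (IHb _ mP)).
Qed.

Lemma recurrentD m m' : recurrent m -> recurrent m' ->
  recurrent (fun x k => m x k + m' x k).
Proof.
move=> mP mP' x bx c g cg xc k; under eq_bigr do rewrite mulrDr.
by rewrite big_split /= (mP x) // (mP' x) // addr0.
Qed.

Lemma recurrentZ l m : recurrent m -> recurrent (fun x k => l * m x k).
Proof.
move=> mP x bx c g cg xc k; under eq_bigr do rewrite mulrCA.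
by rewrite -mulr_sumr (mP x) // mulr0.
Qed.

Lemma recurrent0 : recurrent (fun _ _ => 0).
Proof. by move=> x bx c g cg xc k; rewrite big1 // => i _; rewrite mulr0. Qed.

Definition single x0 (h : int -> F) : fmod := fun x k => if `[< x = x0 >] then h k else 0.

Lemma singleE x0 h : single x0 h x0 = h.
Proof. by rewrite /single asboolT. Qed.

Lemma recurrent_single x0 h : recurrence h x0 -> recurrent (single x0 h).
Proof.
move=> hP x bx c g cg xc k; rewrite /single; case: asboolP => xx0.
  by rewrite xx0 in xc; exact: hP.
by rewrite big1 // => i _; rewrite mulr0.
Qed.

Definition annihilator (Q : fmod -> Prop) : set L :=
  [set a | forall m, Q m -> act P a m = fun _ _ => 0].

Lemma annihilator_ideal (Q : fmod -> Prop) :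
  (forall a m, Q m -> Q (act P a m)) -> is_ideal (annihilator Q).
Proof.
move=> QP; split=> [m _|a b Ia Ib m Qm|l a Ia m Qm|a b Ib m Qm|a b Ia m Qm]; apply: fmodE => x k.
- exact: act0.
- by rewrite actD Ia // Ib // addr0.
- by rewrite actZ Ia // mulr0.
- by rewrite actM Ib // act_f0.
- by rewrite actM Ia //; exact: QP.
Qed.

(** Each [e e^*] projects onto the paths that begin with [e]; what remains of [v] is the path of
    length 0. *)
Lemma act_breaking v m x k : finite_set (out_arrows_avoiding H v) ->
  act P (breaking_element F H v) m x k =
  if `[< [/\ boundary_path P x, (x 0%N).1 = v & (x 0%N).2 = None] >] then m x k else 0.
Proof.
move=> fv; rewrite /breaking_element actB act_vertex fsbig_finite // act_sum.
under eq_bigr do rewrite act_arrow_ghost.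
case: asboolP => [[bx xv]|nb]; last first.
  rewrite big_seq big1 ?subr0 => [|e].
    by rewrite asboolF // => -[bx xv _]; exact: nb.
  rewrite in_fset_set // => /set_mem [/= ev eH].
  rewrite asboolF // => -[bx xe]; apply: nb; split=> //.
  by have [<-] := boundary_head bx xe.
case xe: (x 0%N).2 => [e|]; last first.
  rewrite asboolT // big1 ?subr0 // => e _.
  by rewrite asboolF // => -[].
rewrite asboolF => [|[_ _ //]].
have [se te eH] := boundary_head bx xe.
have ev : e \in fset_set (out_arrows_avoiding H v).
  by rewrite in_fset_set //; apply: mem_set; split=> //=; rewrite -xv -se.
rewrite (bigD1_seq e) ?fset_uniq //= asboolT // big1 ?addr0 ?subrr // => f /eqP fe.
by rewrite asboolF // => -[_ [ef]]; exact: fe.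
Qed.

Lemma act_rpath c d v w m x k : exit_free P c -> {subset d <= c} ->
  is_path v d w -> boundary_path P x -> (x 0%N).1 = v ->
  act P (rpath F d w) m x k = m (shiftn (size d) x) (k + (size d)%:Z) /\
  (shiftn (size d) x 0%N).1 = w.
Proof.
move=> cP; elim: d v x k => [|e d IH] v x k dc /=.
  by move=> -> bx xv; rewrite act_vertex asboolT // addr0.
move=> [sv dw] bx xv; have ec : e \in c by rewrite dc ?mem_head.
rewrite actM act_arrow.
have [xe xt] := exit_free_step bx cP ec (etrans xv (esym sv)).
have [|E xw] := IH _ (shift x) (k + 1) _ dw (boundary_shift bx) xt.
  by move=> f fd; rewrite dc // inE fd orbT.
rewrite asboolT // E.
by rewrite shiftn_shift in xw *; split; rewrite // -addrA -PoszD.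
Qed.

(** The only boundary path at [v] winds around [c] forever and is fixed by the shift of length
    [size c]. On it [c] acts as a translation of the degree, and a polynomial in [c] as a difference
    operator. *)
Lemma act_eval c v (g : {poly F}) m x k : exit_free P c -> is_path v c v ->
  act P (lpa_eval g v c) m x k =
  if `[< boundary_path P x /\ (x 0%N).1 = v >]
  then \sum_(i < size g) g`_i * m x (k + (i * size c)%N%:Z) else 0.
Proof.
move=> cP cv; rewrite (lpa_evalE cv (leqnn _)) act_sum.
case: asboolP => [[bx xv]|nb]; last first.
  rewrite big1 // => i _; rewrite actZ.
  have /= := vertex_rpath F v (pow_path i cv); rewrite eqxx => <-.
  by rewrite actM act_vertex asboolF // mulr0.
apply: eq_bigr => i _; rewrite actZ; congr (_ * _).
have sub : {subset pow c i <= c}.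
  by elim: (nat_of_ord i) => //= j IH e; rewrite mem_cat => /orP[//|/IH].
have [-> xw] := act_rpath m k cP sub (pow_path i cv) bx xv.
have [[c0 _ _] _] := cP; have [e ec ev] := cycle_source c0 cv.
have -> : shiftn (size (pow c i)) x = x.
  apply: (exit_free_unique (boundary_shiftn _ bx) bx cP ec); first by rewrite xw.
  by rewrite ev.
by rewrite /pow size_flatten /shape map_nseq sumn_nseq mulnC.
Qed.

Lemma quadruple_generatorsP (a : L) : quadruple_generators q a <->
  [\/ exists2 v, H v & a = lpa_vertex F v,
      exists2 v, S v & a = breaking_element F H v
    | exists c g v, [/\ theta_rel q c g, is_path v c v & a = lpa_eval g v c]].
Proof.
split=> [[[[v Hv <-]|[v Sv <-]]|[C [v [p [Cp pv ->]]]]]|].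
- by apply: Or31; exists v.
- by apply: Or32; exists v.
- apply: Or33; exists (map (@base_arrow G P) p), (val (quad_theta q C)), (underlying_vertex v).
  by split=> //; [exists C, p|exact: underlying_path].
case=> [[v Hv ->]|[v Sv ->]|[c [g [v [[C [p [Cp pc gE]] cv ->]]]]]].
- by left; left; exists v.
- by left; right; exists v.
right; exists C; have [p0 [w pw] _] := geometric_cycle_cycle Cp.
exists w, p; split=> //; rewrite gE.
have := underlying_path pw; rewrite pc => cw.
have c0 : c != [::] by rewrite -pc -size_eq0 size_map size_eq0.
by rewrite (is_path_start c0 cw cv) -pc.
Qed.

Local Notation K := (ideal_generated (quadruple_generators q)).

Lemma vertex_quadruple_ideal v : H v -> K (lpa_vertex F v).
Proof.
by move=> Hv; apply: sub_ideal_generated; apply/quadruple_generatorsP; apply: Or31; exists v.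
Qed.

Lemma breaking_quadruple_ideal v : S v -> K (breaking_element F H v).
Proof.
by move=> Sv; apply: sub_ideal_generated; apply/quadruple_generatorsP; apply: Or32; exists v.
Qed.

Lemma eval_quadruple_ideal c g v : theta_rel q c g -> is_path v c v -> K (lpa_eval g v c).
Proof.
move=> cg cv; apply: sub_ideal_generated; apply/quadruple_generatorsP.
by apply: Or33; exists c, g, v.
Qed.

Lemma quadruple_ideal_sub : K `<=` annihilator recurrent.
Proof.
apply: ideal_generated_sub; first by apply: annihilator_ideal => a m; exact: act_recurrent.
move=> _ /quadruple_generatorsP[[v Hv ->]|[v Sv ->]|[c [g [v [cg cv ->]]]]] m mP;
  apply: fmodE => x k.
- rewrite act_vertex asboolF // => -[bx xv].
  by apply: (boundary_notin bx); rewrite xv.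
(* A vertex of [S] is regular in the quotient, so no boundary path stops there. *)
- have [iv fv nv] := ap_breaking Sv.
  rewrite act_breaking // asboolF // => -[[_ /(_ 0%N)] + xv xn].
  by rewrite xn xv => -[[]]; split=> //; case.
- have cP := theta_rel_exit_free cg.
  rewrite (act_eval _ _ _ _ cP cv); case: asboolP => // -[bx xv].
  apply: (mP x bx c g cg).
  have [[c0 _ _] _] := cP; have [e ec ev] := cycle_source c0 cv.
  by exists 0%N, e; rewrite xv ev.
Qed.

Lemma recurrence_theta x c g (h : int -> F) : boundary_path P x ->
  theta_rel q c g -> reaches x c ->
  (forall k, \sum_(i < size g) g`_i * h (k + (i * size c)%N%:Z) = 0) -> recurrence h x.
Proof.
move=> bx cg xc hP d g' dg' xd k.
have [n _ cd] := reaches_rotations bx (theta_rel_exit_free cg) (theta_rel_exit_free dg') xc xd.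
have := theta_rel_rot n cg; rewrite cd => dg.
by rewrite (theta_rel_fun dg' dg) -cd size_rot; exact: hP.
Qed.

Lemma recurrence_nontrivial x : boundary_path P x ->
  exists2 h, recurrence h x & h 0 != 0.
Proof.
move=> bx; have [[c [g [cg xc]]]|nx] := pselect (exists c g, theta_rel q c g /\ reaches x c).
  have [sg g0] := theta_rel_poly cg.
  have [[c0 _ _] _] := theta_rel_exit_free cg.
  (* The polynomial 1 is not divisible by [g], which has positive degree; for it the second
     conclusion reads [h 0 != 0]. *)
  have [||h [hP h0]] := @recurrence_solution F g 1 (size c) g0.
  - by rewrite lt0n size_eq0.
  - by rewrite dvdp1 neq_ltn sg orbT.
  exists h; first exact: recurrence_theta cg xc hP.
  by move: h0; rewrite size_poly1 big_ord1 coef1 mul1r.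
exists (fun=> 1); last exact: oner_neq0.
by move=> c g cg xc; case: nx; exists c, g.
Qed.

Lemma quadruple_ideal_vertex v : K (lpa_vertex F v) -> H v.
Proof.
move=> Kv; apply: contrapT => /boundary_exists[x bx xv].
have [h hP /eqP[]] := recurrence_nontrivial bx.
have := quadruple_ideal_sub Kv (recurrent_single hP).
move=> /(congr1 (fun m => m x 0)); rewrite act_vertex asboolT // => <-.
by rewrite singleE.
Qed.

Lemma quadruple_ideal_breaking v : breaking H v -> K (breaking_element F H v) -> S v.
Proof.
move=> Bv Kv; apply: contrapT => vS; have [_ fv _] := Bv.
(* The path of length 0 at [v], which stands for the primed copy of [v]. *)
have bx : boundary_path P (fun=> (v, None)).
  by split=> /= [|_]; [exact: breaking_notin|split=> // -[_ _]; apply].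
have [h hP /eqP[]] := recurrence_nontrivial bx.
have := quadruple_ideal_sub Kv (recurrent_single hP).
move=> /(congr1 (fun m => m (fun=> (v, None)) 0)); rewrite act_breaking // asboolT // => <-.
by rewrite singleE.
Qed.

Lemma quadruple_ideal_eval c v (g : {poly F}) : exit_free P c -> is_path v c v ->
  g != 0 -> K (lpa_eval g v c) -> exists2 f, theta_rel q c f & f %| g.
Proof.
move=> cP cv g0 Kg; apply: contrapT => nf.
have [[c0 _ _] _] := cP.
have n0 : (0 < size c)%N by rewrite lt0n size_eq0.
have [e ec ev] := cycle_source c0 cv.
have [x bx xv] := boundary_exists (exit_free_notin cP cv).
have xc : reaches x c by exists 0%N, e; rewrite xv ev.
have [h hP] : exists2 h, recurrence h x & \sum_(i < size g) g`_i * h (i * size c)%N%:Z != 0.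
  have [[d [f [df xd]]]|nx] := pselect (exists d (f : {poly F}), theta_rel q d f /\ reaches x d).
    have [sf f0] := theta_rel_poly df.
    have [n _ dc] := reaches_rotations bx (theta_rel_exit_free df) cP xd xc.
    have := theta_rel_rot n df; rewrite dc => cf.
    have fg : ~~ (f %| g) by apply/negP => fg; apply: nf; exists f.
    have [h [hP h0]] := recurrence_solution f0 n0 fg.
    by exists h => //; exact: recurrence_theta cf xc hP.
  (* Here no recurrence is imposed on [x]: a Dirac function at the degree of the leading term
     detects the leading coefficient of [g]. *)
  pose i0 := (size g).-1; exists (fun k => (k == (i0 * size c)%N%:Z)%:R).
    by move=> d f df xd; case: nx; exists d, f.
  have i0g : (i0 < size g)%N by rewrite prednK // lt0n size_poly_eq0.
  rewrite (bigD1 (Ordinal i0g)) //= eqxx mulr1 big1 ?addr0 -?lead_coefE ?lead_coef_eq0 //.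
  move=> i; rewrite -val_eqE /= => /negbTE ii0.
  by rewrite eqz_nat eqn_pmul2r // ii0 mulr0.
have := quadruple_ideal_sub Kg (recurrent_single hP).
move=> /(congr1 (fun m => m x 0)); rewrite (act_eval _ _ _ _ cP cv) asboolT // => E.
apply/negP/negPn/eqP; rewrite -[RHS]E; apply: eq_bigr => i _.
by rewrite singleE add0r.
Qed.

Lemma homogeneous_act n (a : L) : has_degree n a -> forall m m' k,
  (forall x, m x (k + n) = m' x (k + n)) ->
  forall x, act P a m x k = act P a m' x k.
Proof.
elim=> {n a} [v|e|e|n|n a b _ IHa _ IHb|n l a _ IHa|n1 n2 a b _ IHa _ IHb] m m' k mm x.
- by have := mm x; rewrite addr0 !act_vertex => ->.
- by rewrite !act_arrow mm.
- by rewrite !act_ghost mm.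
- by rewrite !act0.
- by rewrite !actD (IHa _ m') // (IHb _ m').
- by rewrite !actZ (IHa _ m').
- by rewrite !actM; apply: IHa => y; apply: IHb => z; rewrite -addrA mm.
Qed.

(** The recurrent function [m'] may vary with the degree [j]. This is the closure under truncation
    to one degree, and homogeneous elements that kill [recurrent] kill it too. *)
Definition recurrent_hull m : Prop :=
  forall j, exists2 m', recurrent m' & forall x, m x j = m' x j.

Lemma act_recurrent_hull (a : L) m : recurrent_hull m -> recurrent_hull (act P a m).
Proof.
have homog n (y : L) m' : has_degree n y -> recurrent_hull m' -> recurrent_hull (act P y m').
  move=> ny mP j; have [m1 mP1 mm] := mP (j + n).
  by exists (act P y m1) => [|x]; [exact: act_recurrent|exact: homogeneous_act ny _ _ _ mm x].
rewrite -[a]reprK; elim: (repr a) m => {a} [v|e|e||a IHa b IHb|l a IHa|a IHa b IHb] m mP.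
- exact: (homog 0 _ _ (deg_vertex F v)).
- exact: (homog 1 _ _ (deg_arrow F e)).
- exact: (homog (-1) _ _ (deg_ghost F e)).
- exact: (homog 0 _ _ (deg_zero F G 0)).
- move=> j; have [m1 mP1 mm1] := IHa _ mP j; have [m2 mP2 mm2] := IHb _ mP j.
  exists (fun x k => m1 x k + m2 x k); first exact: recurrentD.
  by move=> x; rewrite -lpa_addE actD mm1 mm2.
- move=> j; have [m1 mP1 mm1] := IHa _ mP j.
  exists (fun x k => l * m1 x k); first exact: recurrentZ.
  by move=> x; rewrite -lpa_scaleE actZ mm1.
- by rewrite -lpa_mulE actM; exact: IHa (IHb _ mP).
Qed.

Lemma quadruple_ideal_nongraded : ~ graded_ideal K.
Proof.
move=> [Y Yh KE].
have YN : Y `<=` annihilator recurrent_hull.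
  move=> y Yy m mP; have Ky : K y by rewrite KE; exact: sub_ideal_generated.
  have [n ny] := Yh _ Yy; apply: fmodE => x k.
  have [m' mP' mm] := mP (k + n); rewrite (homogeneous_act ny mm).
  by rewrite (quadruple_ideal_sub Ky mP').
have KN : K `<=` annihilator recurrent_hull.
  rewrite KE; apply: ideal_generated_sub => //.
  by apply: annihilator_ideal => a m; exact: act_recurrent_hull.
have [C BC] := quad_beta_neq0 q.
have [p Cp] : exists p : seq (arrow (quotient_digraph P)), sval C p.
  by case: (C) => D /= [p _ ->]; exists p; exact: rotations_refl.
pose c := map (@base_arrow G P) p; pose f := val (quad_theta q (exist _ C (mem_set BC))).
have cf : theta_rel q c f by exists (exist _ C (mem_set BC)), p.
have cP := theta_rel_exit_free cf; have [[c0 [v cv] _] _] := cP.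
have [sf f0] := theta_rel_poly cf.
have n0 : (0 < size c)%N by rewrite lt0n size_eq0.
have Kf : K (lpa_eval f v c) by exact: eval_quadruple_ideal.
have [e ec ev] := cycle_source c0 cv.
have [x bx xv] := boundary_exists (exit_free_notin cP cv).
have [h hP h0] := recurrence_nontrivial bx.
(* A solution truncated to degree 0: applied to it in degree 0, [f] retains only its constant term
   and gives [f.[0] * h 0], which is not zero. *)
pose m := single x (fun k => if k == 0 then h 0 else 0).
have mP : recurrent_hull m.
  move=> j; have [->|j0] := eqVneq j 0.
    by exists (single x h) => [|y]; [exact: recurrent_single|rewrite /m /single eqxx].
  exists (fun _ _ => 0); first exact: recurrent0.
  by move=> y; rewrite /m /single (negbTE j0); case: ifP.
have := KN _ Kf _ mP => /(congr1 (fun m => m x 0)); rewrite (act_eval _ _ _ _ cP cv) asboolT // /m singleE.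
have s0 : (0 < size f)%N by exact: ltn_trans sf.
rewrite (bigD1 (Ordinal s0)) //= big1 => [|i]; last first.
  rewrite -val_eqE /= => /negbTE i0; rewrite add0r eqz_nat muln_eq0 i0.
  by rewrite (negbTE (lt0n_neq0 n0)) mulr0.
rewrite addr0 -horner_coef0 f0 mul1r; exact/eqP.
Qed.

End Submodule.

(** * Spanning sets *)

Section Spanning.
Variables (F : fieldType) (G : digraph).
Local Notation L := (lpa F G).
Implicit Types (u v w : vertex G) (e f : arrow G) (p : seq (arrow G)).
Implicit Types (x y z : L) (l : seq (F * seq (arrow G))).
Local Notation V := (lpa_vertex F).
Local Notation A := (lpa_arrow F).
Local Notation A' := (lpa_ghost F).

Inductive real : L -> Prop :=
| real_path u p w : is_path u p w -> real (rpath F p w)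
| real0 : real 0
| realD x y : real x -> real y -> real (x + y)
| realZ k x : real x -> real (k *: x).

Lemma real_arrow x e : real x -> real (x ** A e).
Proof.
elim=> [u p w pw||y z _ ry _ rz|k y _ ry]; rewrite ?lpa_mul0x ?lpa_mulDl ?lpa_mulZl.
- have [we|we] := eqVneq w (source e); last first.
    by rewrite -source_arrow lpa_mulA rpath_vertex (negbTE we) lpa_mul0x; exact: real0.
  have eP : is_path w [:: e] (target e) by [].
  have := rpath_cat F p eP; rewrite /= arrow_target => ->.
  by apply: (@real_path u); apply/is_path_cat; exists w.
- exact: real0.
- exact: realD.
- exact: realZ.
Qed.

Lemma real_vertex x v : real x -> real (x ** V v).
Proof.
elim=> [u p w pw||y z _ ry _ rz|k y _ ry]; rewrite ?lpa_mul0x ?lpa_mulDl ?lpa_mulZl.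
- by rewrite rpath_vertex; case: eqP => _; [exact: real_path pw|exact: real0].
- exact: real0.
- exact: realD.
- exact: realZ.
Qed.

(** The filtration of the span of the [p q^*] by the length of [q]. Right multiplication by an arrow
    lowers it by one. *)
Inductive ghost_degree : nat -> L -> Prop :=
| gd_real n x : real x -> ghost_degree n x
| gdD n x y : ghost_degree n x -> ghost_degree n y -> ghost_degree n (x + y)
| gd_ghost n x e : ghost_degree n x -> ghost_degree n.+1 (x ** A' e).

Lemma gdZ n k x : ghost_degree n x -> ghost_degree n (k *: x).
Proof.
elim=> {n x} [n x rx|n x y _ gx _ gy|n x e _ gx].
- by apply: gd_real; exact: realZ.
- by rewrite scalerDr; exact: gdD.
- by rewrite -lpa_mulZl; exact: gd_ghost.
Qed.

Lemma gd_leq n m x : (n <= m)%N -> ghost_degree n x -> ghost_degree m x.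
Proof.
move=> + gx; elim: gx m => {n x} [n x rx|n x y _ gx _ gy|n x e _ gx] m nm.
- exact: gd_real.
- by apply: gdD; [exact: gx|exact: gy].
- by case: m nm => // m nm; apply: gd_ghost; exact: gx.
Qed.

Lemma gd_vertex n x v : ghost_degree n x -> ghost_degree n (x ** V v).
Proof.
elim=> {n x} [n x rx|n x y _ gx _ gy|n x e gx _].
- by apply: gd_real; exact: real_vertex.
- by rewrite lpa_mulDl; exact: gdD.
- rewrite -lpa_mulA ghost_vertex; case: eqP => _; first exact: gd_ghost.
  by rewrite lpa_mulx0; apply: gd_real; exact: real0.
Qed.

Lemma gd_arrow n x e : ghost_degree n x -> ghost_degree n.-1 (x ** A e).
Proof.
elim=> {n x} [n x rx|n x y _ gx _ gy|n x f gx _].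
- by apply: gd_real; exact: real_arrow.
- by rewrite lpa_mulDl; exact: gdD.
- rewrite -lpa_mulA ghost_arrow; case: eqP => _; first exact: gd_vertex.
  by rewrite lpa_mulx0; apply: gd_real; exact: real0.
Qed.

Lemma gd_term (t : lpa_term F G) n x : ghost_degree n x ->
  exists m, ghost_degree m (x ** \pi_L t).
Proof.
elim: t n x => [v|e|e||a IHa b IHb|k a IHa|a IHa b IHb] n x gx.
- by exists n; exact: gd_vertex.
- by exists n.-1; exact: gd_arrow.
- by exists n.+1; exact: gd_ghost.
- by exists 0%N; rewrite [x ** _]lpa_mulx0; apply: gd_real; exact: real0.
- rewrite -lpa_addE [_ ** _]lpa_mulDr.
  have [m1 g1] := IHa _ _ gx; have [m2 g2] := IHb _ _ gx; exists (maxn m1 m2).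
  by apply: gdD; [apply: gd_leq g1; rewrite leq_maxl|apply: gd_leq g2; rewrite leq_maxr].
- rewrite -lpa_scaleE [_ ** _]lpa_mulZr; have [m gm] := IHa _ _ gx.
  by exists m; exact: gdZ.
- rewrite -lpa_mulE lpa_mulA; have [m gm] := IHa _ _ gx; exact: IHb gm.
Qed.

Lemma gd_exists x : exists n, ghost_degree n x.
Proof.
have gv v : ghost_degree 0 (V v) by apply: gd_real; exact: (@real_path v [::] v).
rewrite -[x]reprK; elim: (repr x) => {x} [v|e|e||a IHa b IHb|k a IHa|a IHa b IHb].
- by exists 0%N; exact: gv.
- by exists 0%N; rewrite -[\pi_L _]source_arrow; exact: (gd_arrow e (gv _)).
- by exists 1%N; rewrite -[\pi_L _]target_ghost; exact: gd_ghost.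
- by exists 0%N; apply: gd_real; exact: real0.
- rewrite -lpa_addE; have [m1 g1] := IHa; have [m2 g2] := IHb; exists (maxn m1 m2).
  by apply: gdD; [apply: gd_leq g1; rewrite leq_maxl|apply: gd_leq g2; rewrite leq_maxr].
- by rewrite -lpa_scaleE; have [m gm] := IHa; exists m; exact: gdZ.
- by rewrite -lpa_mulE; have [m gm] := IHa; exact: gd_term gm.
Qed.

Lemma lpa_piD (a b : lpa_term F G) : \pi_L (TAdd a b) = \pi_L a + \pi_L b.
Proof. by rewrite -lpa_addE. Qed.

Lemma lpa_piZ k (a : lpa_term F G) : \pi_L (TScale k a) = k *: \pi_L a.
Proof. by rewrite -lpa_scaleE. Qed.

(** Finite sums of vertices are local units. Allowing any larger list lets two summands use the same
    one. *)
Lemma local_unit x : exists U : seq (vertex G), forall U', uniq U' -> {subset U <= U'} ->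
  x = \sum_(u <- U') x ** V u.
Proof.
have gen y u : y ** V u = y -> exists U : seq (vertex G), forall U', uniq U' ->
    {subset U <= U'} -> y = \sum_(u <- U') y ** V u.
  move=> yu; exists [:: u] => U' uU' sU.
  rewrite (bigD1_seq u) ?sU ?mem_head //= yu big1 ?addr0 // => w wu.
  by rewrite -yu -lpa_mulA vertex_vertex eq_sym (negbTE wu) lpa_mulx0.
have cat (U1 U2 U' : seq (vertex G)) : {subset U1 ++ U2 <= U'} ->
    {subset U1 <= U'} /\ {subset U2 <= U'}.
  by move=> sub; split=> w wU; apply: sub; rewrite mem_cat wU ?orbT.
rewrite -[x]reprK; elim: (repr x) => {x} [v|e|e||a [Ua IHa] b [Ub IHb]|k a [U IH]|a _ b [U IH]].
- by apply: (gen _ v); rewrite [LHS]vertex_vertex eqxx.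
- by apply: (gen _ (target e)); exact: arrow_target.
- by apply: (gen _ (source e)); exact: ghost_source.
- by exists [::] => U' _ _; rewrite big1 // => w _; exact: lpa_mul0x.
- exists (Ua ++ Ub) => U' uU' /cat[sa sb]; rewrite lpa_piD [LHS](congr2 +%R (IHa _ uU' sa) (IHb _ uU' sb)).
  by rewrite -big_split /=; apply: eq_bigr => w _; rewrite lpa_mulDl.
- exists U => U' uU' sU; rewrite lpa_piZ [LHS](congr1 (fun x => k *: x) (IH _ uU' sU)).
  by rewrite scaler_sumr; apply: eq_bigr => w _; rewrite -lpa_mulZl.
- exists U => U' uU' sU; rewrite -lpa_mulE [LHS](congr1 (lpa_mul _) (IH _ uU' sU)).
  by rewrite lpa_mul_sumr; apply: eq_bigr => w _; rewrite lpa_mulA.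
Qed.

Lemma ideal_local (K : set L) x : is_ideal K -> ~ K x -> exists v, ~ K (x ** V v).
Proof.
move=> iK nKx; apply: contrapT => nex; apply: nKx.
have [U UP] := local_unit x; rewrite (UP (undup U)) ?undup_uniq //; last first.
  by move=> u; rewrite mem_undup.
apply: ideal_sum => // u _; apply: contrapT => nK; apply: nex; by exists u.
Qed.

Definition trunc v (B : seq (arrow G)) : L := V v - \sum_(e <- B) A e ** A' e.

Lemma trunc_nil v : trunc v [::] = V v.
Proof. by rewrite /trunc big_nil subr0. Qed.

Lemma mul_trunc x v B : x ** trunc v B = x ** V v - \sum_(e <- B) x ** A e ** A' e.
Proof.
by rewrite lpa_mulBr lpa_mul_sumr; congr (_ - _); apply: eq_bigr => e _; rewrite lpa_mulA.
Qed.

(** A term that ends with the ghost of [e] vanishes: if [e] starts at [v], by putting [e] in [B];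
    otherwise by orthogonality of vertices. Only the real part [r] survives. *)
Lemma gd_trunc n x v : ghost_degree n x -> exists (B : seq (arrow G)) (r : L), [/\ real r,
  (forall e, e \in B -> source e = v) & forall B', uniq B' -> {subset B <= B'} ->
    (forall e, e \in B' -> source e = v) -> x ** trunc v B' = r ** trunc v B'].
Proof.
elim=> {n x} [n x rx|n x y _ [Bx [rx [Rx Bx1 Bx2]]] _ [By [ry [Ry By1 By2]]]|n x e _ _].
- by exists [::], x.
- exists (Bx ++ By), (rx + ry); split; first exact: realD.
    by move=> e; rewrite mem_cat => /orP[/Bx1|/By1].
  move=> B' uB' sB' sv; rewrite !lpa_mulDl Bx2 ?By2 // => f fB.
    by apply: sB'; rewrite mem_cat fB orbT.
  by apply: sB'; rewrite mem_cat fB.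
have [se|se] := eqVneq (source e) v; last first.
  exists [::], 0; split=> //; first exact: real0.
  move=> B' _ _ sv; rewrite lpa_mul0x -lpa_mulA mul_trunc ghost_vertex (negbTE se).
  rewrite big_seq big1 ?subr0 ?lpa_mulx0 // => f /sv sf.
  by rewrite ghost_arrow; case: eqP => [ef|_]; rewrite ?lpa_mul0x //; rewrite ef sf eqxx in se.
exists [:: e], 0; split; [exact: real0|by move=> f; rewrite inE => /eqP ->|].
move=> B' uB' sB' _; rewrite lpa_mul0x -lpa_mulA mul_trunc ghost_vertex se eqxx.
rewrite (bigD1_seq e) ?sB' ?mem_head //= ghost_arrow eqxx target_ghost.
rewrite big1 ?addr0 ?subrr ?lpa_mulx0 // => f fe.
by rewrite ghost_arrow eq_sym (negbTE fe) lpa_mul0x.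
Qed.

(* Linear combinations of paths with target [v], as lists of coefficients and
   paths. *)
Definition path_sum v l : L := \sum_(a <- l) a.1 *: rpath F a.2 v.
Definition paths_to v l : Prop := forall a, a \in l -> exists u, is_path u a.2 v.

Lemma real_path_sum x v : real x -> exists2 l, paths_to v l & x ** V v = path_sum v l.
Proof.
elim=> [u p w pw||y z _ [ly py Ey] _ [lz pz Ez]|k y _ [ly py Ey]].
- rewrite rpath_vertex; case: eqP => [wv|_].
    exists [:: (1, p)]; last by rewrite /path_sum big_seq1 scale1r wv.
    by move=> a /[!inE] /eqP ->; exists u; rewrite -wv.
  by exists [::] => //; rewrite /path_sum big_nil.
- by exists [::] => //; rewrite /path_sum big_nil lpa_mul0x.
- exists (ly ++ lz); last by rewrite lpa_mulDl Ey Ez /path_sum big_cat.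
  by move=> a; rewrite mem_cat => /orP[/py|/pz].
- exists [seq (k * a.1, a.2) | a <- ly].
    by move=> _ /mapP[a al ->] /=; exact: py.
  rewrite lpa_mulZl Ey /path_sum big_map scaler_sumr.
  by apply: eq_bigr => a _; rewrite scalerA.
Qed.

(** The total coefficient of the paths of length 0. Like [tails], it is attached to the list, where
    a path may occur several times, and not to the element. *)
Fixpoint constant_part l : F :=
  if l is (a, p) :: l' then (if p is _ :: _ then 0 else a) + constant_part l' else 0.

Fixpoint tails e l : seq (F * seq (arrow G)) :=
  if l is (a, p) :: l'
  then if p is f :: p' then (if f == e then (a, p') :: tails e l' else tails e l')
       else tails e l'
  else [::].

Lemma mem_tails e l a p : (a, p) \in tails e l = ((a, e :: p) \in l).
Proof.
elim: l => [|[b [|f q]] l IH] //=; first by rewrite inE xpair_eqE andbF IH.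
rewrite inE xpair_eqE eqseq_cons (eq_sym e f); case: eqVneq => [_|_] /=.
  by rewrite inE xpair_eqE IH.
by rewrite andbF IH.
Qed.

Definition closed_paths v l : Prop :=
  forall a, a \in l -> a.2 != [::] /\ is_path v a.2 v.

Lemma path_sum_cons v a l : path_sum v (a :: l) = a.1 *: rpath F a.2 v + path_sum v l.
Proof. by rewrite /path_sum big_cons. Qed.

Lemma path_sum_split v l hs : uniq hs ->
  (forall a e p, (a, e :: p) \in l -> e \in hs) ->
  path_sum v l = constant_part l *: V v + \sum_(e <- hs) A e ** path_sum v (tails e l).
Proof.
move=> uhs; elim: l => [|[a [|f p]] l IH] hsP.
- rewrite /path_sum big_nil scale0r add0r big1 // => e _.
  by rewrite /= ?big_nil lpa_mulx0.
- rewrite path_sum_cons /= IH ?addrA ?scalerDl // => b e p bl.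
  by apply: (hsP b e p); rewrite inE bl orbT.
rewrite path_sum_cons /= IH => [|b e q bl]; last first.
  by apply: (hsP b e q); rewrite inE bl orbT.
rewrite add0r addrCA; congr (_ + _).
have fhs : f \in hs by apply: (hsP a f p); exact: mem_head.
rewrite (bigD1_seq f) // [RHS](bigD1_seq f) //= eqxx path_sum_cons lpa_mulDr lpa_mulZr addrA.
by congr (_ + _); apply: eq_bigr => e /negbTE; rewrite eq_sym => ->.
Qed.

Lemma vertex_path_sum v l : paths_to v l -> exists2 l', closed_paths v l' &
  V v ** path_sum v l = constant_part l *: V v + path_sum v l'.
Proof.
elim: l => [|[a p] l IH] lP.
  by exists [::] => //; rewrite /path_sum big_nil lpa_mulx0 scale0r add0r.
have [|l' cl' E] := IH; first by move=> b bl; apply: lP; rewrite inE bl orbT.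
have [u pu] := lP _ (mem_head _ _); rewrite /= in pu.
rewrite path_sum_cons lpa_mulDr E lpa_mulZr (vertex_rpath _ _ pu) /=.
case: p pu {lP} => [uv|e p pu].
  by rewrite uv eqxx /=; exists l' => //; rewrite scalerDl addrA.
have [vu|vu] := eqVneq v u; last by exists l' => //; rewrite scaler0 !add0r.
rewrite -vu in pu; exists ((a, e :: p) :: l'); last by rewrite path_sum_cons add0r addrCA.
by move=> b; rewrite inE => /predU1P[->|/cl'//].
Qed.

Lemma paths_to_tails v l e : paths_to v l ->
  forall a, a \in tails e l -> is_path (target e) a.2 v.
Proof. by move=> lP [a p]; rewrite mem_tails => /lP[u []]. Qed.

Lemma vertex_path_sum_from u v l : (forall a, a \in l -> is_path u a.2 v) ->
  V u ** path_sum v l = path_sum v l.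
Proof.
move=> lP; rewrite lpa_mul_sumr /path_sum !big_seq; apply: eq_bigr => a /lP ap.
by rewrite lpa_mulZr (vertex_rpath _ _ ap) eqxx.
Qed.

Lemma ghost_arrow_sum e hs (E : arrow G -> L) : uniq hs -> e \in hs ->
  A' e ** (\sum_(f <- hs) A f ** E f) = V (target e) ** E e.
Proof.
move=> uhs ehs; rewrite lpa_mul_sumr (bigD1_seq e) //= lpa_mulA ghost_arrow eqxx.
rewrite big1 ?addr0 // => f fe.
by rewrite lpa_mulA ghost_arrow eq_sym (negbTE fe) lpa_mul0x.
Qed.

Definition rots e l := [seq (a.1, rcons a.2 e) | a <- tails e l].

Lemma closed_paths_rots v l e : closed_paths v l -> source e = v ->
  closed_paths (target e) (rots e l).
Proof.
move=> lP ev _ /mapP[[a p] + ->]; rewrite mem_tails /= => /lP[_ [_ pv]]; split.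
  by rewrite -size_eq0 size_rcons.
by rewrite -cats1; apply/is_path_cat; exists v.
Qed.

(* Conjugation by [e] rotates the closed paths that start with [e] and kills the
   others. *)
Lemma rots_path_sum v l e : closed_paths v l -> source e = v ->
  A' e ** path_sum v l ** A e = path_sum (target e) (rots e l).
Proof.
move=> lP ev; have {}lP : forall a, a \in l -> is_path v a.2 v /\ a.2 != [::].
  by move=> a /lP[].
rewrite /rots /path_sum big_map lpa_mul_sumr lpa_mul_suml.
elim: l lP => [|[a p] l IH] lP; first by rewrite !big_nil.
rewrite big_cons IH => [|b bl]; last by apply: lP; rewrite inE bl orbT.
have [/= pv] := lP _ (mem_head _ _); case: p pv {lP} => // f p [sf pv] _ /=.
rewrite lpa_mulZr lpa_mulZl (lpa_mulA (A' e)) ghost_arrow eq_sym.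
case: eqVneq => [<-|_]; last by rewrite !lpa_mul0x scaler0 add0r.
rewrite big_cons (vertex_rpath _ _ pv) eqxx; congr (_ *: _ + _).
have ve : is_path v [:: f] (target f) by rewrite /= sf.
by rewrite -cats1 -(rpath_cat _ _ ve) /= arrow_target.
Qed.

End Spanning.

(** * Vertices and closed paths in an arbitrary ideal *)

Section IdealPair.
Variables (F : fieldType) (G : digraph) (I : set (lpa F G)) (iI : is_ideal I).
Local Notation L := (lpa F G).
Implicit Types (u v w : vertex G) (e f : arrow G) (c p q : seq (arrow G)).
Implicit Types (x y z : L) (l : seq (F * seq (arrow G))).
Local Notation V := (lpa_vertex F).
Local Notation A := (lpa_arrow F).
Local Notation A' := (lpa_ghost F).

Definition ideal_vertices : set (vertex G) := [set v | I (V v)].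

Definition ideal_breaking : set (vertex G) :=
  [set v | breaking ideal_vertices v /\ I (breaking_element F ideal_vertices v)].

Lemma ideal_vertices_hereditary : hereditary ideal_vertices.
Proof.
move=> u w p; elim: p u => [|e p IH] u /= Iu; first by move=> <-.
move=> [se]; apply: IH; rewrite /ideal_vertices /=.
have -> : V (target e) = A' e ** (V u ** A e).
  by rewrite -se source_arrow ghost_arrow eqxx.
by apply: (idealMl iI); apply: (idealMr iI).
Qed.

Lemma ideal_vertices_saturated : saturated ideal_vertices.
Proof.
move=> u fu u0 tH; rewrite /ideal_vertices /= lpa_CK2 // fsbig_finite //.
apply: ideal_sum_in => // e; rewrite in_fset_set // => /set_mem eu.
by apply: (idealMr iI); apply: ideal_arrow => //; apply: tH; exists e.
Qed.

Lemma ideal_breaking_sub : ideal_breaking `<=` breaking ideal_vertices.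
Proof. by move=> v []. Qed.

Definition ideal_pair : admissible_pair G :=
  AdmissiblePair ideal_vertices_hereditary ideal_vertices_saturated ideal_breaking_sub.

Local Notation P := ideal_pair.
Local Notation H := (ap_H P).
Local Notation S := (ap_S P).

Lemma path_notin u p w : is_path u p w -> ~ H w -> ~ H u.
Proof. by move=> pw wH Hu; apply: wH; exact: (ideal_vertices_hereditary Hu pw). Qed.

Lemma path_arrow_notin u p w e : is_path u p w -> ~ H w -> e \in p -> ~ H (target e).
Proof.
move=> pw wH ep; case/splitPr: ep pw => p1 p2 /is_path_cat[z _ /= [_ p2w]].
exact: path_notin p2w wH.
Qed.

(* An element [k v + ...] of the ideal, where [k <> 0] and the dots stand for
   closed paths of positive length at a vertex [v], keeps this
   shape with the same [k] when it is conjugated by a path issued from [v]. *)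
Definition anchored v k l : Prop :=
  [/\ k != 0, closed_paths v l & I (k *: V v + path_sum v l)].

Lemma anchored_nil v k : anchored v k [::] -> H v.
Proof. by move=> [k0 _]; rewrite /path_sum big_nil addr0; exact: (idealZV iI k0). Qed.

Lemma anchored_rots v k l e : anchored v k l -> source e = v ->
  anchored (target e) k (rots e l).
Proof.
move=> [k0 cl Ikl] ev; split=> //; first exact: closed_paths_rots cl ev.
have : I (A' e ** (k *: V v + path_sum v l) ** A e).
  by apply: (idealMr iI); apply: (idealMl iI).
rewrite lpa_mulDr lpa_mulDl (rots_path_sum cl ev) lpa_mulZr lpa_mulZl.
by rewrite ghost_vertex ev eqxx ghost_arrow eqxx.
Qed.

(** Conjugation by an arrow rotates some terms and deletes the others, and never creates one. *)
Lemma anchored_path v p w k l : is_path v p w -> anchored v k l ->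
  exists2 l', (size l' <= size l)%N & anchored w k l'.
Proof.
elim: p v l => [|e p IH] v l /=; first by move=> -> kl; exists l.
move=> [ev pw] /anchored_rots/(_ ev) kl; have [l' s' kl'] := IH _ _ pw kl.
exists l' => //; apply: leq_trans s' _; rewrite size_map.
elim: l {kl} => [//|[a [|f q]] l IHl] /=; first exact: leqW.
by case: ifP => _; rewrite ?ltnS //; exact: leqW.
Qed.

Lemma size_tails2 e f l : e <> f ->
  (size (tails e l) + size (tails f l) <= size l)%N.
Proof.
move=> ef; elim: l => [//|[a [|g q]] l IH] /=; first exact: leqW.
have [ge|ge] := eqVneq g e.
  case: eqVneq => [gf|_]; first by case: ef; rewrite -ge.
  by rewrite /= addSn ltnS.
by case: ifP => _; rewrite /= ?addnS ?ltnS //; exact: leqW.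
Qed.

(* If some [e] and [f] branched at [v], both would start closed paths in [l],
   and conjugation by a closed path starting with [e] would shorten [l]. *)
Lemma anchored_unbranched v k l e f : anchored v k l -> ~ H v ->
  source e = v -> source f = v -> ~ H (target e) -> ~ H (target f) -> e = f.
Proof.
have [n] := ubnP (size l); elim: n l => // n IH l ln kl vH se sf He Hf.
apply: contrapT => ef.
(* If no term began with [g], conjugation by [g] would leave only [k] times its target, which would
   lie in [H]. *)
have t0 g : source g = v -> ~ H (target g) -> (0 < size (tails g l))%N.
  move=> sg Hg; rewrite lt0n; apply/negP => /nilP t0; apply: Hg.
  by apply: (@anchored_nil _ k); have := anchored_rots kl sg; rewrite /rots t0.
have [[a p] ap] : exists a, a \in tails e l.
  by have := t0 e se He; case: (tails e l) => // a t _; exists a; exact: mem_head.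
have [_ cl _] := kl; have [_ [_ pv]] := cl _ (etrans (esym (mem_tails _ _ _ _)) ap).
(* Conjugation by [e], then by the rest [p] of a closed path, comes back to [v] without the terms
   that begin with [f]. *)
have [l' s' kl'] := anchored_path pv (anchored_rots kl se).
apply: (ef); apply: (IH l') => //; rewrite -ltnS; apply: leq_trans ln.
rewrite ltnS; apply: leq_ltn_trans s' _; rewrite size_map.
by apply: leq_trans (size_tails2 l ef); rewrite -addn1 leq_add2l; exact: t0.
Qed.

Lemma breaking_element_arrow v e : finite_set (out_arrows_avoiding H v) ->
  source e = v -> ~ H (target e) -> breaking_element F H v ** A e = 0.
Proof.
move=> fv se He; rewrite /breaking_element lpa_mulBl vertex_arrow se eqxx.
rewrite fsbig_finite // lpa_mul_suml (bigD1_seq e) ?fset_uniq //=; last first.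
  by rewrite in_fset_set //; exact: mem_set.
rewrite -lpa_mulA ghost_arrow eqxx arrow_target big1 ?addr0 ?subrr // => f fe.
by rewrite -lpa_mulA ghost_arrow (negbTE fe) lpa_mulx0.
Qed.

Lemma breaking_element_vertex v : finite_set (out_arrows_avoiding H v) ->
  breaking_element F H v ** V v = breaking_element F H v.
Proof.
move=> fv; rewrite /breaking_element lpa_mulBl vertex_vertex eqxx; congr (_ - _).
rewrite fsbig_finite // lpa_mul_suml big_seq [RHS]big_seq.
apply: eq_bigr => e; rewrite in_fset_set // => /set_mem [/= se _].
by rewrite -lpa_mulA ghost_vertex se eqxx.
Qed.

(** With infinitely many arrows towards the complement of [H], one of them is met neither by [B] nor
    by [l], and conjugation by it isolates its target in [I]. With finitely many, left
    multiplication by [v^H] kills all closed paths and puts [v^H] in [I]. *)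
Lemma anchored_regular v k l B : ~ H v -> k != 0 -> closed_paths v l -> uniq B ->
  (forall e, e \in B -> source e = v) ->
  I ((k *: V v + path_sum v l) ** trunc F v B) -> quotient_regular P v.
Proof.
move=> vH k0 cl uB sB; set z := trunc F v B => Iz; apply: contrapT => nr.
have [fv|iv] := pselect (finite_set (out_arrows_avoiding H v)); last first.
  pose T := [set` B] `|` [set` [seq e | e <- flatten (map snd l)]].
  have [f fv fT] : exists2 f, out_arrows_avoiding H v f & ~ T f.
    apply: contrapT => nf; apply: iv; apply: (@sub_finite_set _ _ T).
      by move=> f fv; apply: contrapT => fT; apply: nf; exists f.
    by rewrite finite_setU; split; exact: finite_seq.
  have [/= sf Hf] := fv; apply: Hf.
  have zf : z ** A f = A f.
    rewrite lpa_mulBl vertex_arrow sf eqxx lpa_mul_suml big_seq big1 ?subr0 // => e eB.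
    rewrite -lpa_mulA ghost_arrow; case: eqVneq => [ef|_]; last exact: lpa_mulx0.
    by case: fT; left; rewrite /= -ef.
  have pf : A' f ** path_sum v l = 0.
    rewrite lpa_mul_sumr big_seq big1 // => -[a p] al; rewrite lpa_mulZr.
    have [p0 _] := cl _ al; case: p al p0 => //= e p al _.
    rewrite lpa_mulA ghost_arrow; case: eqVneq => [fe|_]; last first.
      by rewrite lpa_mul0x scaler0.
    case: fT; right; rewrite /= map_id; apply/flattenP; exists (f :: p); last exact: mem_head.
    by apply/mapP; exists (a, f :: p) => //; rewrite fe.
  have : I (A' f ** ((k *: V v + path_sum v l) ** z) ** A f).
    by apply: (idealMr iI); apply: (idealMl iI).
  rewrite !lpa_mulA -lpa_mulA zf lpa_mulDr pf addr0 lpa_mulZr ghost_vertex sf eqxx.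
  by rewrite lpa_mulZl ghost_arrow eqxx; exact: (idealZV iI k0).
set w := breaking_element F H v.
have wl : w ** path_sum v l = 0.
  rewrite lpa_mul_sumr big_seq big1 // => -[a p] al; rewrite lpa_mulZr.
  have [p0 pv] := cl _ al; case: p al p0 pv => //= e p al _ [se pv].
  by rewrite lpa_mulA breaking_element_arrow ?lpa_mul0x ?scaler0 //; exact: path_notin pv vH.
have Iw : I w.
  have : I (w ** ((k *: V v + path_sum v l) ** z)) by apply: (idealMl iI).
  have -> : w ** ((k *: V v + path_sum v l) ** z) = k *: (w ** z).
    by rewrite lpa_mulA [w ** (_ + _)]lpa_mulDr wl addr0 lpa_mulZr breaking_element_vertex // lpa_mulZl.
  (* [w z] is [w] minus terms [w e e^*] of [I]: either [w e = 0], or the target of [e] is in [H]. *)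
  move=> /(idealZV iI k0); rewrite mul_trunc breaking_element_vertex //.
  move=> /(idealBl iI); apply; apply: ideal_sum_in => // e eB.
  have [He|He] := pselect (H (target e)).
    by apply: (idealMr iI); apply: (idealMl iI); exact: ideal_arrow.
  by rewrite breaking_element_arrow ?sB // lpa_mul0x; exact: ideal0.
have [E|/set0P v0] := eqVneq (out_arrows_avoiding H v) set0.
  apply: vH; move: Iw; rewrite /w /breaking_element E fsbig_set0 subr0; exact.
apply: nr; split=> // -[bv nS]; apply: nS; by split.
Qed.

End IdealPair.

(** * Inclusion of ideals from vertices, breaking elements and cycle polynomials *)

Section Reduction.
Variables (F : fieldType) (G : digraph) (I : set (lpa F G)) (iI : is_ideal I).
Local Notation L := (lpa F G).
Implicit Types (u v w : vertex G) (e f : arrow G) (c p q : seq (arrow G)).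
Implicit Types (x y z : L) (l : seq (F * seq (arrow G))).
Local Notation V := (lpa_vertex F).
Local Notation A := (lpa_arrow F).
Local Notation A' := (lpa_ghost F).
Local Notation P := (ideal_pair iI).
Local Notation H := (ap_H P).
Local Notation S := (ap_S P).

Variables (K : set L) (iK : is_ideal K).
Hypothesis HK : forall v, H v -> K (V v).
Hypothesis SK : forall v, S v -> K (breaking_element F H v).

(** An infinite emitter that is regular in the quotient belongs to [S]. For a finite emitter, (CK2)
    turns [v^H] into the sum of the [e e^*] with target in [H]. *)
Lemma regular_breaking_element v : quotient_regular P v -> K (breaking_element F H v).
Proof.
move=> [fv v0 nB]; have [fo|io] := pselect (finite_set (out_arrows v)); last first.
  by apply: SK; apply: contrapT => nS; apply: nB; split=> //; split.
have o0 : out_arrows v !=set0 by case: v0 => e [? _]; exists e.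
rewrite /breaking_element /out_arrows_avoiding lpa_CK2 // (fsbigID (@target G @^-1` (~` H))) //.
rewrite addrC addKr.
have fH : finite_set (out_arrows v `&` ~` (@target G @^-1` (~` H))) by exact: finite_setIl.
rewrite fsbig_finite //; apply: ideal_sum_in => // e.
rewrite in_fset_set // => /set_mem [_ /= /contrapT He].
by apply: (idealMr iK); apply: ideal_arrow => //; exact: HK.
Qed.

(** This is (CK2) modulo [K], valid at every vertex that is regular in the quotient. *)
Lemma regular_mul x v : quotient_regular P v ->
  (forall e, K (x ** A e)) -> K (x ** V v).
Proof.
move=> rv xK; have [fv _ _] := rv.
have : K (x ** breaking_element F H v).
  by apply: (idealMl iK); exact: regular_breaking_element.
rewrite /breaking_element lpa_mulBr => /(idealBl iK); apply.
rewrite fsbig_finite // lpa_mul_sumr; apply: ideal_sum => // e _.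
by rewrite lpa_mulA; apply: (idealMr iK).
Qed.

Lemma ghost_reduction n x : ghost_degree n x -> I x -> ~ K x ->
  exists v (B : seq (arrow G)) (r : L),
    [/\ uniq B /\ (forall e, e \in B -> source e = v), real r,
    I (r ** trunc F v B), ~ K (r ** trunc F v B) & B = [::] \/ ~ quotient_regular P v].
Proof.
elim: n x => [|n IH] x gx Ix nKx.
  have gd0 m y : ghost_degree m y -> m = 0%N -> real y.
    by elim=> // {m y} m y z _ ry _ rz m0; apply: realD; [exact: ry|exact: rz].
  have rx := gd0 _ _ gx erefl.
  have [v nK] := ideal_local iK nKx; exists v, [::], x; rewrite trunc_nil.
  by split=> //; [exact: idealMr|left].
have [[e xe]|nxe] := pselect (exists e, ~ K (x ** A e)).
  by apply: (IH (x ** A e)) => //; [exact: (gd_arrow e gx)|exact: (idealMr iI)].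
(* All products [x e] are in [K], so [x] times [trunc F v B] is congruent to [x v] modulo [K], and
   [regular_mul] shows that [v] is not regular. *)
have {}nxe e : K (x ** A e) by apply: contrapT => nK; apply: nxe; exists e.
have [v nK] := ideal_local iK nKx.
have [B [r [rr sB E]]] := gd_trunc v gx.
have sB' e : e \in undup B -> source e = v by rewrite mem_undup; exact: sB.
have {}E : x ** trunc F v (undup B) = r ** trunc F v (undup B).
  by apply: E; rewrite ?undup_uniq // => e; rewrite mem_undup.
exists v, (undup B), r; rewrite undup_uniq -E; split=> //.
- exact: (idealMr iI).
- rewrite mul_trunc => /(idealBl iK) h; apply: nK; apply: h.
  by apply: ideal_sum => // e _; exact: (idealMr iK).
- by right=> rv; apply: nK; exact: regular_mul.
Qed.

(** Left multiplication by the ghost of [e] shortens the paths, but turns the constant term into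
    [k e^*] if [e] starts at [v]. It is thus used only when [k = 0] or [e] starts elsewhere; if
    neither applies, the product by [v] on the left has the desired shape. *)
Lemma path_reduction v z l : V v ** z = z -> paths_to v l ->
  I (path_sum v l ** z) -> ~ K (path_sum v l ** z) ->
  exists k l', [/\ k != 0, closed_paths v l', I ((k *: V v + path_sum v l') ** z)
    & ~ K ((k *: V v + path_sum v l') ** z)].
Proof.
move=> vz; have [n] : exists n, forall a, a \in l -> (size a.2 < n)%N.
  exists (\max_(a <- l) size a.2).+1%N => a al.
  by rewrite ltnS (big_rem a) //= leq_maxl.
elim: n l => [|n IH] l ln lP; set y := path_sum v l ** z => Iy nKy.
  case: nKy; rewrite /y; case: l ln {lP y Iy} => [_|a l /(_ a (mem_head _ _))//].
  by rewrite /path_sum big_nil lpa_mul0x; exact: ideal0.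
(* The first arrows of the paths of [l]; [take 1] contributes nothing for a path of length 0. *)
pose hs := undup (flatten [seq take 1 a.2 | a <- l]); have uhs : uniq hs by exact: undup_uniq.
have hsP a e p : (a, e :: p) \in l -> e \in hs.
  move=> al; rewrite mem_undup; apply/flattenP; exists (take 1 (e :: p)).
    by apply/mapP; exists (a, e :: p).
  by rewrite /= take0 mem_head.
set k := constant_part l; pose r e := path_sum v (tails e l).
have split_l : path_sum v l = k *: V v + \sum_(e <- hs) A e ** r e by exact: path_sum_split.
have rP e : e \in hs -> k = 0 \/ source e <> v -> A' e ** y = r e ** z.
  move=> ehs kv; rewrite /y lpa_mulA split_l [A' e ** (_ + _)]lpa_mulDr.
  rewrite ghost_arrow_sum // lpa_mulZr ghost_vertex vertex_path_sum_from; last first.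
    exact: paths_to_tails.
  case: kv => [->|/eqP/negbTE ->]; first by rewrite scale0r add0r.
  by rewrite scaler0 add0r.
have step e : e \in hs -> k = 0 \/ source e <> v -> ~ K (A e ** r e ** z) ->
    exists k l', [/\ k != 0, closed_paths v l', I ((k *: V v + path_sum v l') ** z)
      & ~ K ((k *: V v + path_sum v l') ** z)].
  move=> ehs kv nK; apply: (IH (tails e l)).
  - by move=> [a p]; rewrite mem_tails => /ln.
  - by move=> a al; exists (target e); exact: paths_to_tails al.
  - by rewrite -/(r e) -rP //; exact: (idealMl iI).
  - by move=> Kr; apply: nK; rewrite -lpa_mulA; exact: (idealMl iK).
have [k0|k0] := eqVneq k 0.
  have [e [ehs nK]] : exists e, e \in hs /\ ~ K (A e ** r e ** z).
    apply: contrapT => nex; apply: nKy; rewrite /y split_l k0 scale0r add0r lpa_mul_suml.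
    apply: ideal_sum_in => // e ehs; apply: contrapT => nK; apply: nex; by exists e.
  by apply: step ehs _ nK; left.
have [l' cl' vl] := vertex_path_sum lP.
have [Kv|nKv] := pselect (K (V v ** y)); last first.
  exists k, l'; rewrite -vl -lpa_mulA; split=> //; exact: (idealMl iI).
(* As [v y] is in [K], the part of [y] that starts away from [v] is not. *)
have [e [ehs sev nK]] : exists e, [/\ e \in hs, source e <> v & ~ K (A e ** r e ** z)].
  apply: contrapT => nex; apply: nKy; apply: (idealBl iK) Kv.
  have -> : y - V v ** y = \sum_(e <- hs) (A e - V v ** A e) ** (r e ** z).
    rewrite /y split_l [V v ** (_ ** _)]lpa_mulA -lpa_mulBl [V v ** _]lpa_mulDr.
    rewrite lpa_mulZr vertex_vertex eqxx opprD addrACA subrr add0r lpa_mul_sumr.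
    rewrite -sumrB lpa_mul_suml; apply: eq_bigr => e _.
    by rewrite !lpa_mulBl !lpa_mulA.
  apply: ideal_sum_in => // e ehs; rewrite vertex_arrow.
  have [_|ve] := eqVneq v (source e); first by rewrite subrr lpa_mul0x; exact: ideal0.
  rewrite subr0 lpa_mulA; apply: contrapT => nK; apply: nex; exists e; split=> //.
  by apply/eqP; rewrite eq_sym.
by apply: step ehs _ nK; right.
Qed.

Hypothesis CK : forall c v (g : {poly F}), exit_free P c -> is_path v c v ->
  I (lpa_eval g v c) -> K (lpa_eval g v c).

(* The branching vertices are excluded by [anchored_unbranched], so that a
   closed path of minimal length at [v] is an exit-free cycle. *)
Lemma anchored_exit_free v k l : anchored I v k l -> ~ H v ->
  exists2 c, exit_free P c & is_path v c v /\
    forall p, is_path v p v -> exists i, p = pow c i.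
Proof.
move=> kl vH; have [k0 cl _] := kl.
have reg w p : is_path v p w -> ~ H w -> quotient_regular P w.
  move=> pw wH; have [l' _ [_ cl' Il']] := anchored_path iI pw kl.
  apply: (anchored_regular (B := [::]) wH k0 cl') => //.
  by rewrite trunc_nil; exact: (idealMr iI).
have unb w p e f : is_path v p w -> ~ H w -> source e = w -> source f = w ->
    ~ H (target e) -> ~ H (target f) -> e = f.
  move=> pw wH; have [l' _ kl'] := anchored_path iI pw kl.
  exact: anchored_unbranched kl' wH.
have exc : exists n, `[< exists2 c, c != [::] /\ is_path v c v & size c = n >].
  case: l kl cl => [/(anchored_nil iI)//|a l _ /(_ a (mem_head _ _)) [a0 av]].
  by exists (size a.2); apply/asboolP; exists a.2.
have [n /asboolP[c [c0 cv] sc] minc] := ex_minnP exc.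
have {}minc p : p != [::] -> is_path v p v -> (size c <= size p)%N.
  by move=> p0 pv; rewrite sc; apply: minc; apply/asboolP; exists p.
(* A repeated source would allow cutting out the segment between its two occurrences, against
   minimality. *)
have uc : uniq (map (@source G) c).
  apply/negPn/negP => /(uniqPn v)[i [j [ij]]]; rewrite size_map => jc.
  have e0 : arrow G by case: (c) c0.
  rewrite !(nth_map e0) //; last exact: ltn_trans jc.
  move=> sij.
  have short : is_path v (take i c ++ drop j c) v.
    have := cv; rewrite -{1}(cat_take_drop i c) => /is_path_cat[u ui uv].
    have := cv; rewrite -{1}(cat_take_drop j c) => /is_path_cat[u' _ uv'].
    apply/is_path_cat; exists u => //.
    move: uv; rewrite (drop_nth e0) ?(ltn_trans ij) //= => -[su _].
    move: uv'; rewrite (drop_nth e0) //= => -[su' ?].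
    by rewrite -su sij.
  have short0 : take i c ++ drop j c != [::].
    by rewrite -size_eq0 size_cat size_drop addn_eq0 subn_eq0 leqNgt jc andbF.
  have := minc _ short0 short; rewrite size_cat size_take size_drop (ltn_trans ij jc).
  by rewrite leqNgt -[ltnRHS](subnKC (ltnW jc)) ltn_add2r ij.
have cP : exit_free P c.
  split; first by split=> //; exists v.
  move=> e ec; have He := path_arrow_notin cv vH ec.
  have [p pe seH] : exists2 p, is_path v p (source e) & ~ H (source e).
    case/splitPr: ec cv => p1 p2 /is_path_cat[w p1w [sw p2v]]; exists p1; rewrite sw //.
    by apply: (@path_notin _ _ _ iI _ (e :: p2) v).
  split=> //; first exact: reg pe seH.
  by move=> f sf Hf; apply: (unb _ _ _ _ pe).
(* Paths do not branch, so a nonempty closed path at [v] begins with [c]; the remainder is handled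
   by induction. *)
exists c => //; split=> // p; have [m] := ubnP (size p).
elim: m p => // m IH p pm pv; have [->|p0] := eqVneq p [::]; first by exists 0%N.
have uq e f : e \in c -> f \in p -> source f = source e -> f = e.
  by have [_ cP'] := cP; move=> /cP'[_ _ ue] /(path_arrow_notin pv vH) Hf /ue; apply.
have [q pE qv] := path_prefix uq cv pv (minc _ p0 pv).
have [|//|i qE] := IH q.
  by rewrite -ltnS; apply: leq_trans pm; rewrite ltnS pE size_cat -{1}[size q]add0n ltn_add2r lt0n size_eq0.
by exists i.+1; rewrite pE qE.
Qed.

Lemma ideal_reduction : I `<=` K.
Proof.
move=> x Ix; apply: contrapT => nKx; have [n gx] := gd_exists x.
have [v [B [r [[uB sB] rr Irz nKrz BP]]]] := ghost_reduction gx Ix nKx.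
set z := trunc F v B in Irz nKrz.
have vz : V v ** z = z.
  rewrite lpa_mulBr vertex_vertex eqxx lpa_mul_sumr; congr (_ - _).
  rewrite big_seq [RHS]big_seq; apply: eq_bigr => e /sB se.
  by rewrite lpa_mulA vertex_arrow se eqxx.
have [l lP rl] := real_path_sum v rr.
rewrite -vz lpa_mulA rl in Irz nKrz.
have [k [l' [k0 cl Ik nKk]]] := path_reduction vz lP Irz nKrz.
have vH : ~ H v.
  move=> Hv; apply: nKk; apply: (idealMl iK).
  by rewrite -vz; apply: (idealMr iK); exact: HK.
have rv := anchored_regular vH k0 cl uB sB Ik.
(* Since [v] is regular in the quotient, only the case without truncation is left. *)
case: BP => [B0|//]; rewrite /z B0 trunc_nil in Ik nKk.
have sv : (k *: V v + path_sum v l') ** V v = k *: V v + path_sum v l'.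
  rewrite lpa_mulDl lpa_mulZl vertex_vertex eqxx lpa_mul_suml; congr (_ + _).
  by apply: eq_bigr => a _; rewrite lpa_mulZl rpath_vertex eqxx.
rewrite sv in Ik nKk.
have kl : anchored I v k l' by [].
have [c cP [cv powc]] := anchored_exit_free kl vH.
have [g gE] : exists g : {poly F}, lpa_eval g v c = path_sum v l'.
  elim: l' cl {Ik nKk sv kl} => [|[a p] l' IHl] cl.
    by exists 0; rewrite /lpa_eval size_poly0 big_ord0 /path_sum big_nil.
  have [|g gE] := IHl; first by move=> b bl; apply: cl; rewrite inE bl orbT.
  have [_ /= /powc[i pE]] := cl _ (mem_head _ _).
  exists (a *: 'X^i + g); rewrite lpa_evalD // lpa_evalZ // lpa_eval_Xn // gE.
  by rewrite path_sum_cons -pE.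
apply: nKk; have E : k *: V v + path_sum v l' = lpa_eval (k *: 'X^0 + g) v c.
  by rewrite lpa_evalD // lpa_evalZ // lpa_eval_Xn // gE.
by rewrite E; apply: CK => //; rewrite -E.
Qed.

End Reduction.

(** * The quadruple of a non-graded ideal *)

Section EvalIdeal.
Variables (F : fieldType) (G : digraph) (I : set (lpa F G)) (iI : is_ideal I).
Implicit Types (v w : vertex G) (c : seq (arrow G)) (f g h : {poly F}).

Lemma ideal_eval0 v c : I (lpa_eval 0 v c).
Proof. by rewrite /lpa_eval size_poly0 big_ord0; exact: ideal0. Qed.

Lemma ideal_evalM v c g h : is_path v c v ->
  I (lpa_eval g v c) -> I (lpa_eval (h * g) v c).
Proof.
move=> cv Ig; elim/poly_ind: h => [|h a IH]; first by rewrite mul0r; exact: ideal_eval0.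
rewrite mulrDl mulrAC mulrC mul_polyC lpa_evalD // lpa_evalZ // lpa_eval_XM //.
by apply: (idealD iI); [exact: (idealMl iI)|exact: (idealZ iI)].
Qed.

(** The cycle is rotated one arrow at a time; a nonempty path determines its base vertex, which
    identifies [w]. *)
Lemma ideal_eval_rot v w c n g : c != [::] -> is_path v c v -> is_path w (rot n c) w ->
  I (lpa_eval g v c) -> I (lpa_eval g w (rot n c)).
Proof.
move=> c0 cv; elim: n w => [|n IH] w; first by rewrite rot0 => /(is_path_start c0 cv) ->.
have [cn|nc] := leqP (size c) n.
  by rewrite rot_oversize ?leqW // => /(is_path_start c0 cv) ->.
rewrite rotS // => cw Ig; have [u cu] := rot_path cv (ltnW nc).
move: (IH u cu Ig) (cu) cw; have : rot n c != [::] by rewrite -size_eq0 size_rot size_eq0.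
case: (rot n c) => // e q _ Ie eu; rewrite rot1_cons => cw.
have -> : w = target e.
  have qe : is_path (target e) (rcons q e) (target e).
    have [ue qu] := eu; rewrite -cats1; apply/is_path_cat; exists u => //.
  by apply: is_path_start cw qe; rewrite -size_eq0 size_rcons.
rewrite -(lpa_eval_rot1 _ eu).
by apply: (idealMr iI); apply: (idealMl iI).
Qed.

(** The polynomials in question form an ideal of [{poly F}], generated by a nonzero element of
    minimal size. Its constant term is nonzero because the ghost path of [c] would cancel a factor
    [X]; it can thus be normalized to 1. A constant generator would put [v] in [I]. *)
Lemma ideal_eval_generator v c g0 : is_path v c v -> ~ I (lpa_vertex F v) ->
  g0 != 0 -> I (lpa_eval g0 v c) ->
  exists f, [/\ (1 < size f)%N, f.[0] = 1 & forall g, I (lpa_eval g v c) <-> f %| g].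
Proof.
move=> cv vI g00 Ig0.
have exg : exists n, `[< exists g, [/\ g != 0, I (lpa_eval g v c) & size g = n] >].
  by exists (size g0); apply/asboolP; exists g0.
have [n /asboolP[f [f0 If sf]] minf] := ex_minnP exg.
have {}minf g : I (lpa_eval g v c) -> (size g < size f)%N -> g = 0.
  move=> Ig; apply: contraTeq => gn0; rewrite -leqNgt sf.
  by apply: minf; apply/asboolP; exists g.
have f00 : f`_0 != 0.
  apply/eqP => f0E; pose h : {poly F} := drop_poly 1 f.
  have fE : f = 'X * h.
    apply/polyP => -[|i]; rewrite coefXM //= coef_drop_poly addn1 //.
  have h0 : h != 0 by apply: contraNneq f0 => h0; rewrite fE h0 mulr0.
  have : h = 0; last exact/eqP.
  apply: minf; last first.
    by rewrite [in ltnRHS]fE mulrC size_mulX.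
  have : I (gpath F c v ** lpa_eval f v c) by exact: (idealMl iI).
  rewrite fE lpa_eval_XM // lpa_mulA (gpathK F cv).
  rewrite (lpa_evalE cv (leqnn _)) lpa_mul_sumr.
  congr I; apply: eq_bigr => i _; rewrite lpa_mulZr.
  by rewrite (vertex_rpath _ _ (pow_path i cv)) eqxx.
exists ((f`_0)^-1 *: f); split.
- rewrite size_scale ?invr_eq0 // ltnNge; apply/negP => /size1_polyC fE.
  apply: vI; apply: (idealZV iI f00); move: If.
  rewrite [f in lpa_eval f]fE -[(f`_0)%:P]mulr1 mul_polyC -(expr0 'X).
  by rewrite lpa_evalZ // lpa_eval_Xn.
- by rewrite hornerZ horner_coef0 mulVf.
move=> g; rewrite dvdpZl ?invr_eq0 //; split=> [Ig|/dvdpP[h ->]]; last exact: ideal_evalM.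
apply/eqP; apply: minf; last by rewrite ltn_modp.
have -> : g %% f = g + (- (g %/ f)) * f.
  by apply/eqP; rewrite mulNr eq_sym subr_eq addrC -divp_eq.
by rewrite lpa_evalD //; apply: (idealD iI) => //; exact: ideal_evalM.
Qed.

End EvalIdeal.

(** * Every non-graded ideal comes from a quadruple *)

Section Surjectivity.
Variables (F : fieldType) (G : digraph) (I : set (lpa F G)) (iI : is_ideal I).
Local Notation P := (ideal_pair iI).
Local Notation H := (ap_H P).
Local Notation S := (ap_S P).
Local Notation D := (quotient_digraph P).
Local Notation und := (@base_arrow G P).

Definition ideal_cycles : set (geometric_cycle D) :=
  [set C | no_exit C /\ exists p v (g : {poly F}), [/\ sval C p, is_path v (map und p) v,
     g != 0 & I (lpa_eval g v (map und p))]].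

Lemma theta_exists : exists theta : ideal_cycles -> {f : {poly F} | (1 < size f)%N && (f.[0] == 1)},
  forall C p v g, sval (val C) p -> is_path v (map und p) v ->
    I (lpa_eval g v (map und p)) <-> val (theta C) %| g.
Proof.
suff /choice[theta thetaP] : forall C : ideal_cycles, exists f : {f : {poly F} | (1 < size f)%N && (f.[0] == 1)},
    forall p v (g : {poly F}), sval (val C) p -> is_path v (map und p) v ->
    I (lpa_eval g v (map und p)) <-> val f %| g by exists theta.
move=> [C /[dup] /set_mem [nC [p [v [g [Cp pv g0 Ig]]]]] Cmem] /=.
have cP := no_exit_exit_free nC Cp.
have [f [sf f0 fP]] := ideal_eval_generator iI pv (exit_free_notin cP pv) g0 Ig.
have f_ok : (1 < size f)%N && (f.[0] == 1) by rewrite sf f0 eqxx.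
exists (exist _ f f_ok) => p' v' g' /= Cp' pv'; rewrite -fP.
(* Changing the representative and its base vertex is a rotation, which preserves membership in
   [I]. *)
have rot_eval q q' w w' : sval C q -> sval C q' -> is_path w (map und q) w ->
    is_path w' (map und q') w' ->
    I (lpa_eval g' w (map und q)) -> I (lpa_eval g' w' (map und q')).
  move=> Cq Cq' qw qw'; have [[c0 _ _] _] := no_exit_exit_free nC Cq.
  have : rotations q q' by rewrite -(geometric_cycle_rotations Cq).
  move=> [n _ qn]; rewrite -qn map_rot in qw' *.
  exact: ideal_eval_rot.
by split; apply: rot_eval.
Qed.

Lemma theta_no_exit C : ideal_cycles C -> no_exit C.
Proof. by case. Qed.

Lemma nongraded_ideal_surj : ~ graded_ideal I ->
  exists q : quadruple F G, ideal_generated (quadruple_generators q) = I.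
Proof.
move=> ngI; have [theta thetaP] := theta_exists.
have cyc c v g : exit_free P c -> is_path v c v -> g != 0 -> I (lpa_eval g v c) ->
    exists2 C, ideal_cycles C & exists2 p, sval C p & map und p = c.
  move=> cP cv g0 Ig; have [C [nC [p Cp pc]]] := exit_free_no_exit cP.
  by exists C; [split=> //; exists p, v, g; rewrite pc|exists p].
have [bn0|b0] := pselect (ideal_cycles !=set0).
  exists (Quadruple bn0 theta_no_exit theta); set q := Quadruple _ _ _.
  set K := ideal_generated _; have iK : is_ideal K by exact: ideal_generated_ideal.
  have KI : K `<=` I.
    apply: ideal_generated_sub => // x /quadruple_generatorsP[[v Hv ->]//|[v [_ Iv] ->]//|].
    move=> [c [g [v [[C [p [Cp pc gE]]] cv ->]]]].
    by rewrite -pc in cv *; apply/(thetaP C p v g Cp cv); rewrite -gE.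
  apply/seteqP; split=> //; apply: (ideal_reduction (iI := iI) iK).
  - exact: (@vertex_quadruple_ideal _ _ q).
  - exact: (@breaking_quadruple_ideal _ _ q).
  move=> c v g cP cv Ig; have [->|g0] := eqVneq g 0; first exact: ideal_eval0.
  have [C bC [p Cp pc]] := cyc c v g cP cv g0 Ig.
  pose C' : ideal_cycles := exist _ C (mem_set bC).
  rewrite -pc in cv Ig *; have /(thetaP C' p v g Cp cv)/dvdpP[h ->] := Ig.
  apply: (ideal_evalM iK) => //; apply: (@eval_quadruple_ideal _ _ q) => //.
  by exists C', p.
(* Without cycles, the vertices and breaking elements of [I] generate it, and they are homogeneous
   of degree 0. *)
case: ngI.
pose X := (@lpa_vertex F G @` H) `|` (breaking_element F H @` S).
exists X.
  move=> _ [[v _ <-]|[v Sv <-]]; exists 0; first exact: deg_vertex.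
  have [_ fv _] := ap_breaking Sv.
  apply: deg_add; first exact: deg_vertex.
  rewrite -scaleN1r; apply: deg_scale; rewrite fsbig_finite //.
  apply: big_ind; [exact: deg_zero|by move=> x y; exact: deg_add|move=> e _].
  exact: (deg_mul (deg_arrow F e) (deg_ghost F e)).
have iK := ideal_generated_ideal X.
have KI : ideal_generated X `<=` I.
  by apply: ideal_generated_sub => // _ [[v Hv <-]|[v [_ Iv] <-]].
apply/seteqP; split=> //; apply: (ideal_reduction (iI := iI) iK).
- by move=> v Hv; apply: sub_ideal_generated; left; exists v.
- by move=> v Sv; apply: sub_ideal_generated; right; exists v.
move=> c v g cP cv Ig; have [->|g0] := eqVneq g 0; first exact: ideal_eval0.
by have [C bC _] := cyc c v g cP cv g0 Ig; case: b0; exists C.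
Qed.

End Surjectivity.

(** The ideal determines [H], then [S], and then each polynomial up to mutual divisibility; the
    value 1 at 0 fixes the remaining scalar. *)
Lemma quadruple_ideal_inj (F : fieldType) (G : digraph) (q1 q2 : quadruple F G) :
  ideal_generated (quadruple_generators q1) = ideal_generated (quadruple_generators q2) ->
  q1 = q2.
Proof.
have subH (p q : quadruple F G) :
    ideal_generated (quadruple_generators p) = ideal_generated (quadruple_generators q) ->
    ap_H (quad_pair p) `<=` ap_H (quad_pair q).
  move=> E v Hv; apply: quadruple_ideal_vertex; rewrite -E; exact: vertex_quadruple_ideal.
have subS (p q : quadruple F G) :
    ideal_generated (quadruple_generators p) = ideal_generated (quadruple_generators q) ->
    ap_H (quad_pair p) = ap_H (quad_pair q) -> ap_S (quad_pair p) `<=` ap_S (quad_pair q).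
  move=> E EH v Sv; apply: quadruple_ideal_breaking.
    by rewrite -EH; exact: ap_breaking Sv.
  by rewrite -E -EH; exact: breaking_quadruple_ideal.
have subtheta (p q : quadruple F G) :
    ideal_generated (quadruple_generators p) = ideal_generated (quadruple_generators q) ->
    quad_pair p = quad_pair q -> forall c f, theta_rel p c f ->
    exists2 g, theta_rel q c g & g %| f.
  move=> E EP c f cf; have [sf f0] := theta_rel_poly cf.
  have cP := theta_rel_exit_free cf; have [[_ [v cv] _] _] := cP.
  apply: (quadruple_ideal_eval _ cv); first by rewrite -EP.
    by rewrite -size_poly_gt0 (ltn_trans _ sf).
  by rewrite -E; exact: eval_quadruple_ideal.
have eqtheta (p q : quadruple F G) :
    ideal_generated (quadruple_generators p) = ideal_generated (quadruple_generators q) ->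
    quad_pair p = quad_pair q -> forall c f, theta_rel p c f -> theta_rel q c f.
  move=> E EP c f cf; have [g cg gf] := subtheta _ _ E EP c f cf.
  have [f' cf' fg] := subtheta _ _ (esym E) (esym EP) c g cg.
  rewrite (theta_rel_fun cf' cf) in fg.
  have [_ f0] := theta_rel_poly cf; have [_ g0] := theta_rel_poly cg.
  have /eqpP[[a b] /= /andP[a0 b0] ab] : f %= g by rewrite /eqp fg.
  move: (ab) => /(congr1 (fun h : {poly F} => h.[0])); rewrite !hornerZ f0 g0 !mulr1 => ab0.
  by rewrite -ab0 in ab; rewrite (scalerI a0 ab).
move=> E.
have EH : ap_H (quad_pair q1) = ap_H (quad_pair q2).
  by apply/seteqP; split; [exact: subH E|exact: subH (esym E)].
have ES : ap_S (quad_pair q1) = ap_S (quad_pair q2).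
  by apply/seteqP; split; [exact: subS E EH|exact: subS (esym E) (esym EH)].
have EP := admissible_pair_eq EH ES.
by apply: quadruple_eq EH ES _ _; [exact: eqtheta|exact: eqtheta (esym E) (esym EP)].
Qed.

Theorem theorem11 (F : fieldType) (G : digraph) :
  exists Phi : quadruple F G -> nongraded_ideal F G,
    bijective Phi /\
    forall q, sval (Phi q) = ideal_generated (quadruple_generators q).
Proof.
pose Phi q : nongraded_ideal F G :=
  exist _ (ideal_generated (quadruple_generators q))
    (conj (ideal_generated_ideal _) (@quadruple_ideal_nongraded F G q)).
have PhiE q : sval (Phi q) = ideal_generated (quadruple_generators q) by [].
exists Phi; split=> //.
have inj : injective Phi.
  by move=> q1 q2 /(congr1 sval); rewrite !PhiE; exact: quadruple_ideal_inj.
have /choice[Psi PsiK] : forall I : nongraded_ideal F G, exists q, Phi q = I.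
  move=> [I [iI nI]]; have [q qI] := nongraded_ideal_surj iI nI.
  by exists q; apply: eq_exist.
by exists Psi => // q; apply: inj; rewrite PsiK.
Qed.
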